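(* 1. Every maximal outerplanar graph $G$ on $n \geq 6$ vertices satisfies $4 \leq mp(G) \leq n-1$. 2. There exist arbitrarily large maximal outerplanar graphs $G$ with $mp(G) = 4$; that is, for every $N$ there is a maximal outerplanar graph $G$ with at least $N$ vertices and $mp(G)=4$. 3. There exist arbitrarily large maximal outerplanar graphs $G$ with no regular edges and $mp(G) = 4$; that is, for every $N$ there is a maximal outerplanar graph $G$ with at least $N$ vertices, no regular edges, and $mp(G)=4$.
   Context: Graphs are finite and simple. A path $P = v_1 v_2 \ldots v_k$ (distinct vertices, consecutive ones adjacent) in a graph $G$ is a degree monotone path of length $k$ if $\deg(v_1) \leq \deg(v_2) \leq \ldots \leq \deg(v_k)$ or $\deg(v_1) \geq \deg(v_2) \geq \ldots \geq \deg(v_k)$, where degrees are taken in $G$; thus the length of a path is its number of vertices. $mp(G)$ denotes the maximum length of a degree monotone path in $G$. A maximal outerplanar graph is an outerplanar graph such that adding any edge between two nonadjacent vertices yields a graph that is not outerplanar. An edge $xy$ of $G$ is regular if $\deg(x) = \deg(y)$. *)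

(* Defs.v *)
From HB Require Import structures.
From mathcomp Require Import all_boot all_order all_algebra.
From mathcomp Require Import all_classical all_reals all_analysis.
Set Implicit Arguments.
Unset Strict Implicit.
Unset Printing Implicit Defensive.
Import Order.TTheory GRing.Theory Num.Theory.
Import numFieldNormedType.Exports.
Local Open Scope classical_set_scope.
Local Open Scope ring_scope.

Definition simple_graph (V : finType) (e : rel V) : Prop :=
  symmetric e /\ irreflexive e.

Definition deg (V : finType) (e : rel V) (x : V) : nat := #|[pred y | e x y]|.

Definition degree_monotone_path (V : finType) (e : rel V) (s : seq V) : bool :=
  [&& uniq s, sorted e s &
      sorted (fun x y => (deg e x <= deg e y)%N) s
      || sorted (fun x y => (deg e x >= deg e y)%N) s].

(* The vertices of a path are distinct, so its length is at most #|V|.  The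
   empty sequence also satisfies [degree_monotone_path]; it only contributes
   the value 0 to the maximum. *)
Definition mp (V : finType) (e : rel V) : nat :=
  \max_(k < #|V|.+1 | [exists s : k.-tuple V, degree_monotone_path e s]) k.

Definition regular_edge (V : finType) (e : rel V) (x y : V) : bool :=
  e x y && (deg e x == deg e y).

Definition add_edge (V : finType) (e : rel V) (x y : V) : rel V :=
  fun u v => [|| e u v, (u == x) && (v == y) | (u == y) && (v == x)].

Definition is_arc (R : realType) (A : set (R * R)) (a b : R * R) : Prop :=
  exists g : R -> R * R,
    [/\ {within `[0, 1], continuous g},
        {in `[0, 1] &, injective g},
        g 0 = a, g 1 = b & A = g @` `[0, 1]].

(* The last two conditions say that an edge contains no vertex other than its
   ends, and that distinct edges meet only at vertices (hence only at a common
   end). *)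
Definition plane_drawing (R : realType) (V : finType) (e : rel V)
    (pos : V -> R * R) (arc : V -> V -> set (R * R)) : Prop :=
  [/\ injective pos,
      forall x y, e x y -> is_arc (arc x y) (pos x) (pos y),
      forall x y, e x y -> arc x y = arc y x,
      forall x y, e x y -> arc x y `&` range pos `<=` [set pos x; pos y] &
      forall x y u v, e x y -> e u v -> [set x; y] <> [set u; v] ->
        arc x y `&` arc u v `<=` range pos].

Definition drawing_points (R : realType) (V : finType) (e : rel V)
    (pos : V -> R * R) (arc : V -> V -> set (R * R)) : set (R * R) :=
  [set q | range pos q \/ exists x y, e x y /\ arc x y q].

(* The complement of a compact set [D] of the plane has exactly one unbounded
   connected component. *)
Definition outer_face (R : realType) (D : set (R * R)) : set (R * R) :=
  [set q | ~ D q /\ ~ bounded_set (connected_component (~` D) q)].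

(* All vertices lie on the boundary of the outer face; the outer face is
   disjoint from the drawing, so for a vertex being on the boundary is the same
   as being in the closure. *)
Definition outerplanar (R : realType) (V : finType) (e : rel V) : Prop :=
  exists (pos : V -> R * R) (arc : V -> V -> set (R * R)),
    plane_drawing e pos arc /\
    forall v, closure (outer_face (drawing_points e pos arc)) (pos v).

Definition maximal_outerplanar (R : realType) (V : finType) (e : rel V) : Prop :=
  [/\ simple_graph e,
      outerplanar R e &
      forall x y, x != y -> ~~ e x y -> ~ outerplanar R (add_edge e x y)].

(* Main.v *)
Require Import Defs.
From mathcomp Require Import all_boot all_order all_algebra.
From mathcomp Require Import all_classical all_reals all_analysis.
From mathcomp Require Import ring lra zify.
Set Implicit Arguments.
Unset Strict Implicit.
Unset Printing Implicit Defensive.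
Import Order.TTheory GRing.Theory Num.Theory.
Import numFieldNormedType.Exports.

(** Crossings are counted modulo 2 throughout, on finely sampled curves.

    From drawings to combinatorics.  For a curve [g] and a point [z] off it,
    [curve_parity g z] is the parity of the number of times [g] crosses the
    horizontal ray going right from [z].  Two disjoint curves satisfy one linear
    relation between the parities of either curve at the ends of the other
    ([curve_parity_exchange]): the difference of the two curves is a map from a
    square to the punctured plane, so its parity along the boundary is zero.  If
    the vertex [w] lies on the outer face, the parities at [w] of the edges that
    avoid [w] are of the form [b w x (+) b w y]: that is clear for points far
    away, and nothing changes along a connected set missing the drawing
    ([parity_coboundary_unbounded]).  Combining the two facts gives a tournament
    [t] on the vertices in which any two vertex-disjoint edges [xy] and [uv]
    satisfy [link t x y u v = false] ([outerplanar_tournament]).  For a convex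
    polygon, [t] can be the order of the vertices, and [link] says whether two
    chords cross.  In general [t] need not be a linear order, but its existence
    already excludes K4 and K23 minors ([tournament_no_K4], [tournament_no_K23],
    with [link_connect] to replace edges by connected sets).

    From tournaments to orders.  Without a K4 minor some vertex has degree at
    most 2 ([low_degree_vertex]).  Deleting it, and joining its two neighbours
    [a] and [b] if it has two, gives a smaller graph with the same tournament.
    In a noncrossing order of the smaller graph the vertex can be put back,
    unless [a] and [b] are joined by paths on both sides of the edge [ab], and
    then there is a K23 minor.  Hence outerplanar graphs have noncrossing vertex
    orders ([noncrossing_order]).  Conversely a noncrossing order gives a drawing
    by chords of a parabola, every vertex being reached from below
    ([noncrossing_outerplanar]).  So maximal outerplanar graphs are exactly the
    triangulated polygons ([maximal_outerplanar_polygon],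
    [polygon_maximal_outerplanar]).

    Degree monotone paths in a triangulated polygon.  There are two vertices of
    degree 2, and no two such vertices are adjacent, whereas a spanning monotone
    path would start with two of them: this is the upper bound ([mp_lt_card]).
    For the lower bound, take a shortest chord [pq] that cuts off at least two
    vertices; the third vertex [v] of the triangle on it has degree 3 or 4 and is
    adjacent to a vertex [w] of degree 2, and [w], [v] followed by [p] and [q] in
    increasing order of degrees is the path sought ([mp_ge4]).

    The examples.  In [fan] the vertices fall into four levels such that adjacent
    vertices have different levels and the degree increases with the level
    along every edge ([fan_level_deg]); so no edge is regular and a monotone path
    visits each level at most once. *)

(** * Tournaments and forbidden minors *)

(** For points of a convex polygon, with [t] their order along the boundary, this
    is the parity of the crossings of the chords [xy] and [uv]. *)
Definition link (V : finType) (t : V -> V -> bool) (x y u v : V) : bool :=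
  (t x u (+) t x v) (+) (t y u (+) t y v).

(** [t] plays the part of the order of the vertices along the outer face, but the
    topology only yields a tournament, possibly with cycles. *)
Definition outer_tournament (V : finType) (e : rel V) (t : V -> V -> bool) :=
  (forall x y, x != y -> t y x = ~~ t x y) /\
  (forall x y u v, e x y -> e u v ->
     x != u -> x != v -> y != u -> y != v -> link t x y u v = false).

Definition within_rel (V : finType) (A : pred V) (e : rel V) : rel V :=
  fun x y => [&& A x, A y & e x y].

Lemma within_rel_sym (V : finType) (A : pred V) (e : rel V) :
  symmetric e -> symmetric (within_rel A e).
Proof. by move=> e_sym x y; rewrite /within_rel e_sym andbCA. Qed.

Lemma connect_within_sub (V : finType) (A B : pred V) (e e' : rel V) :
    (forall x y, A x -> A y -> e x y -> [&& B x, B y & e' x y]) ->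
  subrel (connect (within_rel A e)) (connect (within_rel B e')).
Proof.
move=> AB; apply: connect_sub => x y /and3P[Ax Ay exy].
by apply: connect1; exact: AB.
Qed.

Lemma connect_within_sym (V : finType) (A : pred V) (e : rel V) x y :
  symmetric e -> connect (within_rel A e) x y = connect (within_rel A e) y x.
Proof. by move=> e_sym; apply: sym_connect_sym; exact: within_rel_sym. Qed.

Section Links.
Variables (V : finType) (e : rel V) (t : V -> V -> bool).
Hypothesis et : outer_tournament e t.

(** [link] is additive along a walk in either pair of arguments, so paths, and
    more generally connected sets, may replace edges. *)
Lemma link_connect (A B : pred V) x y u v : (forall z, A z -> ~~ B z) ->
    connect (within_rel A e) x y -> connect (within_rel B e) u v ->
  link t x y u v = false.
Proof.
move=> AB.
have AneB z w : A z -> B w -> z != w.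
  by move=> Az Bw; apply: contraTneq Az => ->; apply: contraL Bw; exact: AB.
have link_edge z w : within_rel A e z w -> connect (within_rel B e) u v ->
    link t z w u v = false.
  move=> /and3P[Az Aw ezw] /connectP[p + ->].
  elim: p u => [|u' p IH] u1 /=; first by rewrite /link !addbb.
  case/andP=> /and3P[Bu Bu' euu'] /IH IHp.
  have := et.2 _ _ _ _ ezw euu' (AneB _ _ Az Bu) (AneB _ _ Az Bu')
    (AneB _ _ Aw Bu) (AneB _ _ Aw Bu').
  move: IHp; rewrite /link.
  by case: (t z (last _ _)); case: (t w (last _ _)); case: (t z u');
     case: (t w u'); case: (t z u1); case: (t w u1).
move=> /connectP[p + ->] cuv.
elim: p x => [|x' p IH] x1 /=.
  by move=> _; rewrite /link; case: (t x1 u); case: (t x1 v).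
case/andP=> /link_edge/(_ cuv) Lx /IH; move: Lx; rewrite /link.
by case: (t x1 u); case: (t x1 v); case: (t x' u); case: (t x' v);
   case: (t (last _ _) u); case: (t (last _ _) v).
Qed.

(** The hypotheses are the three pairs of opposite edges of K4.  In their sum
    every pair of vertices occurs twice, and for exactly three of the six pairs
    the two occurrences have opposite orientations, so the sum is [true]. *)
Lemma tournament_no_K4 a b c d : a != b -> a != c -> b != c ->
  link t a b c d = false -> link t b c d a = false -> link t a c b d = false ->
  False.
Proof.
move=> ab ac bc; rewrite /link (et.1 _ _ ab) (et.1 _ _ ac) (et.1 _ _ bc).
by case: (t a b); case: (t a c); case: (t a d); case: (t b c); case: (t b d);
   case: (t c d).
Qed.

(** Same count as for K4: in the sum of the six relations everything cancels but
    the pairs [bi, bj], which occur once in each orientation. *)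
Lemma tournament_no_K23 a1 a2 b1 b2 b3 : b1 != b2 -> b1 != b3 -> b2 != b3 ->
  link t a1 b1 a2 b2 = false -> link t a1 b2 a2 b1 = false ->
  link t a1 b1 a2 b3 = false -> link t a1 b3 a2 b1 = false ->
  link t a1 b2 a2 b3 = false -> link t a1 b3 a2 b2 = false ->
  False.
Proof.
move=> b12 b13 b23.
rewrite /link (et.1 _ _ b12) (et.1 _ _ b13) (et.1 _ _ b23).
by case: (t a1 a2); case: (t a1 b1); case: (t a1 b2); case: (t a1 b3);
   case: (t b1 a2); case: (t b2 a2); case: (t b3 a2);
   case: (t b1 b2); case: (t b1 b3); case: (t b2 b3).
Qed.

End Links.

Section LongestPath.
Variables (V : finType) (e : rel V).
Hypotheses (e_sym : symmetric e) (e_irr : irreflexive e).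

Lemma longest_path x0 y0 : e x0 y0 -> exists m, [/\ 2 <= m,
   exists s, [/\ uniq s, sorted e s & size s = m] &
   forall s, uniq s -> sorted e s -> size s <= m].
Proof.
move=> exy; pose P k := [exists s : k.-tuple V, uniq s && sorted e s].
have P2 : P 2.
  apply/existsP; exists [tuple x0; y0]; rewrite /= exy inE !andbT.
  by apply: contraTneq exy => ->; rewrite e_irr.
have Pmax k : P k -> k <= #|V|.
  case/existsP=> s /andP[us _].
  by rewrite -(size_tuple s) -(card_uniqP us) max_card.
have [m /existsP[s /andP[us es]] mP] := ex_maxnP (ex_intro _ 2 P2) Pmax.
exists m; split; first exact: mP.
  by exists s; rewrite size_tuple.
move=> s' us' es'; apply: mP; apply/existsP; exists (in_tuple s').
by rewrite us'.
Qed.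

Definition segment (s : seq V) p q : pred V :=
  fun x => (x \in s) && (p <= index x s <= q).

Lemma segment_connect x0 s p q : uniq s -> sorted e s -> p <= q < size s ->
  connect (within_rel (segment s p q) e) (nth x0 s p) (nth x0 s q).
Proof.
move=> us /(sortedP x0) es /andP[]; elim: q => [|q IH] pq qs.
  by move: pq; rewrite leqn0 => /eqP ->.
move: pq; rewrite leq_eqVlt => /predU1P[-> //|pq].
apply: (@connect_trans _ _ (nth x0 s q)).
  apply: connect_within_sub (IH pq (ltnW qs)) => x y.
  rewrite /segment => /andP[-> /andP[-> xq]] /andP[-> /andP[-> yq]] ->.
  by rewrite !leqW.
apply: connect1; rewrite /within_rel /segment es // !mem_nth ?(ltnW qs) //.
rewrite !index_uniq ?(ltnW qs) //; lia.
Qed.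

(** Otherwise the path could be extended at its first vertex. *)
Lemma longest_path_closed x s m y : uniq (x :: s) -> sorted e (x :: s) ->
    (forall s, uniq s -> sorted e s -> size s <= m) -> size (x :: s) = m ->
  e x y -> y \in x :: s.
Proof.
move=> us es smax sm exy; apply/negPn/negP => ys.
have := smax (y :: x :: s); rewrite /= -sm ltnn.
by move=> H; suff : false by []; apply: H; rewrite /= ?ys // e_sym exy.
Qed.

(** Replacing the edge from [s_(i-1)] to [s_i] by an edge from [s_0] to [s_i]
    turns the path around: it now starts at [s_(i-1)]. *)
Definition rotate_path s i : seq V := rev (take i s) ++ drop i s.

Lemma nth_rotate_path x0 s i k : i <= size s ->
  nth x0 (rotate_path s i) k = if k < i then nth x0 s (i.-1 - k) else nth x0 s k.
Proof.
move=> si; rewrite nth_cat size_rev size_takel //; case: ifP => ki.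
  by rewrite nth_rev size_takel // nth_take; [congr nth|]; lia.
by rewrite nth_drop subnKC // leqNgt ki.
Qed.

Lemma rotate_pathP x0 s i : uniq s -> sorted e s -> 0 < i < size s ->
    e (nth x0 s 0) (nth x0 s i) ->
  [/\ uniq (rotate_path s i), sorted e (rotate_path s i)
    & size (rotate_path s i) = size s].
Proof.
move=> us /(sortedP x0) es /andP[i0 si] ei.
have sz : size (rotate_path s i) = size s.
  by rewrite size_cat size_rev -size_cat cat_take_drop.
split=> //.
  rewrite (@perm_uniq _ _ s) // -[X in perm_eq _ X](cat_take_drop i).
  by rewrite perm_cat2r perm_rev.
apply/(sortedP x0) => k; rewrite sz => ks; rewrite !nth_rotate_path ?(ltnW si) //.
case: (ltngtP k.+1 i) => ki.
- have -> : i.-1 - k = (i.-1 - k.+1).+1 by lia.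
  by rewrite e_sym es //; lia.
- by rewrite es.
- by rewrite -ki /= subnn ki.
Qed.

(** Suppose that all degrees are at least 3 or 0.  Among the longest paths choose
    one whose first vertex has its second neighbour along the path as early as
    possible, at index [i].  Both this path and its rotation at [i] start with a
    vertex having a further neighbour beyond [i], by minimality; these two chords
    cross each other and give a K4 minor on the vertices of index [0], [i-1], [i]
    and the end of the second chord. *)
Lemma low_degree_vertex t x0 y0 : outer_tournament e t -> e x0 y0 ->
  exists v a b, e v a /\ forall z, e v z -> z = a \/ z = b.
Proof.
move=> et exy.
have [|nlow] := boolP [exists v, exists a, exists b, e v a &&
    [forall z, e v z ==> (z == a) || (z == b)]].
  case/existsP=> v /existsP[a /existsP[b /andP[eva /forallP H]]].
  by exists v, a, b; split=> // z; move/implyP: (H z) => Hz /Hz /orP[] /eqP; auto.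
exfalso.
have third v a b : e v a -> exists z, [/\ e v z, z != a & z != b].
  move=> eva; move: nlow; rewrite negb_exists => /forallP/(_ v).
  rewrite negb_exists => /forallP/(_ a); rewrite negb_exists => /forallP/(_ b).
  rewrite eva /= negb_forall => /existsP[z]; rewrite negb_imply negb_or.
  by case/and3P=> ? ? ?; exists z.
have [m [m2 [s0 [us0 es0 ss0]] smax]] := longest_path exy.
pose chord (s : seq V) i := [&& uniq s, sorted e s, 1 < i < m &
  e (nth x0 s 0) (nth x0 s i)].
have chordP s a b : uniq s -> sorted e s -> size s = m ->
    e (nth x0 s 0) a -> exists2 i, 0 < i < m &
    [/\ e (nth x0 s 0) (nth x0 s i), nth x0 s i != a & nth x0 s i != b].
  move=> us es sm /(third _ _ b)[z [ez za zb]].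
  case: s us es sm ez => [|x s] us es sm ez; first by move: m2; rewrite -sm.
  have zs := longest_path_closed us es smax sm ez.
  exists (index z (x :: s)); last by rewrite nth_index.
  rewrite -sm index_mem zs andbT lt0n; apply: contraTneq ez => z0.
  by rewrite -(nth_index x0 zs) z0 e_irr.
have step s i : uniq s -> sorted e s -> size s = m -> i.+1 < m ->
    e (nth x0 s i) (nth x0 s i.+1).
  by move=> _ /(sortedP x0) es <-; exact: es.
have chord_ex : exists i, [exists s : m.-tuple V, chord s i].
  have e01 := step s0 0 us0 es0 ss0 m2.
  have [i im [ei i1 _]] := chordP s0 _ (nth x0 s0 1) us0 es0 ss0 e01.
  exists i; apply/existsP; exists (tcast ss0 (in_tuple s0)).
  rewrite val_tcast /chord us0 es0 ei andbT /=.
  have : i != 1 by apply: contraNneq i1 => ->.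
  lia.
have [i /existsP[s /and4P[us es /andP[i1 im] ei]] imin] := ex_minnP chord_ex.
have ss := size_tuple s.
have {}imin s' k : uniq s' -> sorted e s' -> size s' = m -> 1 < k < m ->
    e (nth x0 s' 0) (nth x0 s' k) -> i <= k.
  move=> us' es' ss' km ek; apply: imin; apply/existsP.
  by exists (tcast ss' (in_tuple s')); rewrite val_tcast /chord us' es' km.
pose f := nth x0 s.
have f_inj k l : k < m -> l < m -> k != l -> f k != f l.
  by move=> km lm; rewrite /f nth_uniq ?ss.
(* the chord of [s] at its first vertex, beyond [i] *)
have [j jm [ej j1 ji]] := chordP s _ (f i) us es ss (step s 0 us es ss m2).
have {ji} ij : i < j.
  have j1' : j != 1 by apply: contraNneq j1 => ->.
  have ji' : j != i by apply: contraNneq ji => ->.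
  have j1m : 1 < j < m by clear -jm j1'; lia.
  have := imin s j us es ss j1m ej; clear -ji'; lia.
have i01 : 0 < i < m by clear -i1 im; lia.
have [ur er sr] : [/\ uniq (rotate_path s i), sorted e (rotate_path s i)
    & size (rotate_path s i) = m].
  by have := @rotate_pathP x0 s i us es _ ei; rewrite ss; apply.
have r0 : nth x0 (rotate_path s i) 0 = f i.-1.
  by rewrite nth_rotate_path ?ss ?(ltnW im) // subn0 (ltnW i1).
(* the chord of the rotated path at its first vertex, which is [f i.-1] *)
have [k km [ek k1 ki]] := chordP _ _ (f i) ur er sr (step _ 0 ur er sr m2).
have {k1 ki} ik : i < k.
  have k1' : k != 1 by apply: contraNneq k1 => ->.
  have ki' : k != i.
    by apply: contraNneq ki => ->; rewrite nth_rotate_path ?ss ?(ltnW im) // ltnn.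
  have k1m : 1 < k < m by clear -km k1'; lia.
  have := imin _ k ur er sr k1m ek; clear -ki'; lia.
move: ek; rewrite r0 nth_rotate_path ?ss ?(ltnW im) // ltnNge (ltnW ik) /= -/f => ek.
have idx l : l < m -> index (f l) s = l by move=> lm; rewrite index_uniq ?ss.
have mem l : l < m -> f l \in s by move=> lm; rewrite mem_nth ?ss.
have ei' : e (f i.-1) (f i).
  by have := step s i.-1 us es ss; rewrite prednK ?(ltnW i1) //; apply.
have i0m : 0 < i.-1 < m by clear -i1 im; lia.
have i1i : i.-1 < i < m by clear -i1 im; lia.
have [j_lt k_lt] : j < m /\ 0 < k < m by clear -jm km ik; lia.
have ine : i.-1 != k /\ 0 != i.-1 by clear -ik i0m; lia.
apply: (@tournament_no_K4 _ e t et (f 0) (f i.-1) (f i) (f k)).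
- by apply: f_inj; clear -i0m; lia.
- by apply: f_inj; clear -i01; lia.
- by apply: f_inj; clear -i1i; lia.
- apply: (link_connect et (A := segment s 0 i.-1) (B := segment s i k)).
  + by move=> z; rewrite /segment => /andP[-> zi] /=; clear -zi i1i; lia.
  + by apply: segment_connect; rewrite ?ss //; clear -i0m; lia.
  + by apply: segment_connect; rewrite ?ss //; clear -ik k_lt; lia.
- apply: (link_connect et (A := segment s i.-1 i)
    (B := fun x => (x == f 0) || segment s (minn j k) (maxn j k) x)).
  + move=> z; rewrite /segment => /andP[-> zi] /=; rewrite negb_or.
    apply/andP; split; last by clear -zi ij ik; lia.
    by apply: contraTneq zi => ->; rewrite idx; clear -i0m; lia.
  + by apply: segment_connect; rewrite ?ss //; clear -i1i; lia.
  + apply: (@connect_trans _ _ (f j)); last first.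
      apply: connect1; rewrite /within_rel /segment eqxx e_sym ej !andbT /=.
      by rewrite mem ?idx ?orbT //=; clear; lia.
    have seg : connect (within_rel (segment s (minn j k) (maxn j k)) e) (f k) (f j).
      case: (leqP j k) => jk; last first.
        by apply: segment_connect; rewrite ?ss // j_lt ltnW.
      rewrite connect_within_sym //; apply: segment_connect; rewrite ?ss //.
      by rewrite jk; case/andP: k_lt.
    by apply: connect_within_sub seg => x y -> -> ->; rewrite !orbT.
- by apply: et.2 => //; apply: f_inj; clear -i0m i01 i1i ik k_lt ine; lia.
Qed.

End LongestPath.

(** * Noncrossing vertex orders *)

Definition noncrossing (V : finType) (e : rel V) (f : V -> nat) :=
  forall x y u v, e x y -> e u v -> f x < f u -> f u < f y -> f y < f v -> False.

Section Orders.
Variable V : finType.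
Implicit Types (e : rel V) (f : V -> nat).

Lemma noncrossing_sub e e' f : subrel e e' -> noncrossing e' f -> noncrossing e f.
Proof. by move=> ee nc x y u v /ee xy /ee uv; exact: nc. Qed.

(** Rotates the cyclic order underlying [f], so that the first vertex is the first
    one with label at least [c]. *)
Definition rotate_order f c z : nat :=
  if f z < c then f z + (\max_w f w).+1 else f z.

Lemma rotate_order_inj f c : injective f -> injective (rotate_order f c).
Proof.
move=> f_inj x y; rewrite /rotate_order => E; apply: f_inj.
have := leq_bigmax (F := f) x; have := leq_bigmax (F := f) y.
by case: ifP E; case: ifP => *; lia.
Qed.

Lemma rotate_order_noncrossing e f c : symmetric e ->
  noncrossing e f -> noncrossing e (rotate_order f c).
Proof.
move=> e_sym nc x y u v exy euv.
have eyx : e y x by rewrite e_sym.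
have evu : e v u by rewrite e_sym.
have := leq_bigmax (F := f) x; have := leq_bigmax (F := f) y.
have := leq_bigmax (F := f) u; have := leq_bigmax (F := f) v.
have := (nc _ _ _ _ exy euv, nc _ _ _ _ exy evu, nc _ _ _ _ eyx euv, nc _ _ _ _ eyx evu).
have := (nc _ _ _ _ euv exy, nc _ _ _ _ evu exy, nc _ _ _ _ euv eyx, nc _ _ _ _ evu eyx).
rewrite /rotate_order; clear.
move: (f x) (f y) (f u) (f v) (\max_w f w) => a b p q M.
move=> [[[n1 n2] n3] n4] [[[m1 m2] m3] m4].
by case: ifP => ?; case: ifP => ?; case: ifP => ?; case: ifP => ?; lia.
Qed.

(** Labels are doubled to make room: [v] goes just before the label [p]. *)
Definition insert_order f (v : V) p z : nat := if z == v then p.*2 else (f z).*2.+1.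

Lemma insert_order_inj f v p : injective f -> injective (insert_order f v p).
Proof.
move=> f_inj x y; rewrite /insert_order.
case: eqP => [->|_]; case: eqP => [->|_] //; try lia.
by move=> E; apply: f_inj; lia.
Qed.

(** The edge of a leaf [v] placed right after its neighbour [a] has nothing
    between its ends. *)
Lemma noncrossing_insert_leaf e f v a : symmetric e ->
    (forall z, e v z -> z = a) ->
    noncrossing (fun x y => [&& x != v, y != v & e x y]) f ->
  noncrossing e (insert_order f v (f a).+1).
Proof.
move=> e_sym va nc x y u w exy euw.
have va' z : e z v -> z = a by rewrite e_sym; exact: va.
rewrite /insert_order.
have [?|xv] := eqVneq x v; first subst x.
  have ? := va _ exy; subst y.
  by case: (eqVneq a v) => _; case: (eqVneq u v) => _; lia.
have [?|yv] := eqVneq y v; first subst y.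
  have ? := va' _ exy; subst x.
  by case: (eqVneq u v) => _; lia.
have [?|uv] := eqVneq u v; first subst u.
  have ? := va _ euw; subst w.
  by case: (eqVneq a v) => _; lia.
have [?|wv] := eqVneq w v; first subst w.
  have ? := va' _ euw; subst u.
  lia.
move=> *; apply: (nc x y u w); rewrite ?xv ?yv ?uv ?wv //; lia.
Qed.

(** The position [p] lies under the edge [ab] of [e'], and the last hypothesis says
    that no other edge passes over [p] within [ab].  An edge of [e] crossing [va]
    or [vb] would have to do this or to cross [ab]. *)
Lemma noncrossing_insert_between e e' f v a b p :
    symmetric e -> e' a b -> f a < p <= f b -> a != v -> b != v ->
    (forall z, e v z -> z = a \/ z = b) ->
    (forall x y, x != v -> y != v -> e x y -> e' x y) ->
    noncrossing e' f ->
    (forall x y, x != v -> y != v -> e x y -> f a <= f x < p -> p <= f y <= f b ->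
       x = a /\ y = b) ->
  noncrossing e (insert_order f v p).
Proof.
move=> e_sym ab /andP[ap pb] av bv vab ee' nc cut x y u w exy euw.
have vab' z : e z v -> z = a \/ z = b by rewrite e_sym; exact: vab.
rewrite /insert_order.
have [?|xv] := eqVneq x v.
  subst x.
  have [?|uv] := eqVneq u v; first lia.
  have [?|wv] := eqVneq w v; first lia.
  have [?|?] := vab _ exy; subst y; rewrite ?(negPf av) ?(negPf bv); first lia.
  by move=> h1 h2 h3; apply: (nc _ _ _ _ ab (ee' _ _ uv wv euw));
     clear -ap pb h1 h2 h3; lia.
have [?|yv] := eqVneq y v.
  subst y.
  have [?|uv] := eqVneq u v; first lia.
  have [?|wv] := eqVneq w v; first lia.
  have [?|?] := vab' _ exy; subst x; last lia.
  move=> au up pw.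
  have [wb|bw] := leqP (f w) (f b).
    have [] := cut u w uv wv euw; try (clear -au up pw wb; lia).
    by move=> ua; move: au; rewrite ua ltnn.
  by apply: (nc _ _ _ _ ab (ee' _ _ uv wv euw)); clear -ap pb au up pw bw; lia.
have [?|uv] := eqVneq u v.
  subst u.
  have [?|wv] := eqVneq w v; first lia.
  have [?|?] := vab _ euw; subst w; first lia.
  move=> xp py yb.
  have [ax|xa] := leqP (f a) (f x).
    have [] := cut x y xv yv exy; try (clear -ax xp py yb; lia).
    by move=> _ E; move: yb; rewrite E ltnn.
  by apply: (nc _ _ _ _ (ee' _ _ xv yv exy) ab); clear -ap pb xp py yb xa; lia.
have [?|wv] := eqVneq w v.
  subst w.
  have [?|?] := vab' _ euw; subst u; last lia.
  by move=> h1 h2 h3; apply: (nc _ _ _ _ (ee' _ _ xv yv exy) ab);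
     clear -ap pb h1 h2 h3; lia.
by move=> h1 h2 h3; apply: (nc _ _ _ _ (ee' _ _ xv yv exy) (ee' _ _ uv wv euw));
     clear -ap pb h1 h2 h3; lia.
Qed.

(** A discrete intermediate value theorem along a path. *)
Lemma connect_straddle (r : rel V) f a t c : connect r a t -> f a < c <= f t ->
  exists i j, [/\ connect r a i, r i j, f i < c & c <= f j].
Proof.
case/connectP=> p + ->; elim/last_ind: p => [_|p z IH]; first by rewrite /=; lia.
rewrite rcons_path last_rcons => /andP[pp rz] /andP[ac cz].
have [cl|lc] := leqP c (f (last a p)); first by apply: IH; rewrite // ac.
by exists (last a p), z; split=> //; apply/connectP; exists p.
Qed.

(** Let [t] be the last vertex that is reachable from [a] between [a] and [b]
    without using [b].  An edge passing over the gap after [t] starts at a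
    reachable vertex, since it cannot cross the path from [a] to [t]; as [t] is
    the last one, that edge ends at [b] and a bridge from [a] to [b] is found. *)
Lemma cut_or_bridge e e' f a b :
    injective f -> symmetric e -> subrel e e' -> noncrossing e' f -> f a < f b ->
  (exists2 p, f a < p <= f b & forall x y, e x y ->
     f a <= f x < p -> p <= f y <= f b -> x = a /\ y = b) \/
  (exists z, [/\ f a < f z < f b, e z b,
     connect (within_rel (fun x => f a <= f x < f b) e) a z &
     connect (within_rel (fun x => f a < f x <= f b) e) z b]).
Proof.
move=> f_inj e_sym ee' nc ab.
pose I x := f a <= f x < f b.
pose S := connect (within_rel I e) a.
have SI x : S x -> I x.
  case/connectP=> p + ->; elim/last_ind: p => [_|p z IH]; first by rewrite /I /= leqnn ab.
  by rewrite rcons_path last_rcons => /andP[_ /and3P[]].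
have Sa : S a by exact: connect0.
case: (arg_maxnP f Sa) => t St tmax.
have /andP[at_ tb] := SI _ St.
pose bad x y := [&& e x y, f a <= f x <= f t, f t < f y <= f b
  & ~~ ((x == a) && (y == b))].
have [/existsP[x /existsP[y /and4P[exy axt tyb nab]]]|nbad] :=
    boolP [exists x, exists y, bad x y].
- right.
  have Sx : S x.
    apply: contraT => nSx.
    have xa : x != a by apply: contraNneq nSx => ->.
    have xt : x != t by apply: contraNneq nSx => ->.
    have fxa : f x != f a by rewrite inj_eq.
    have fxt : f x != f t by rewrite inj_eq.
    have axt' : f a < f x <= f t by clear -axt fxa; lia.
    have [i [j [Si /and3P[Ii Ij eij] ix xj]]] := connect_straddle St axt'.
    have Sj : S j by apply: connect_trans Si (connect1 _); rewrite /within_rel Ii Ij.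
    have xj' : f x != f j by rewrite inj_eq //; apply: contraNneq nSx => ->.
    have jt := tmax _ Sj.
    exfalso; apply: (nc i j x y (ee' _ _ eij) (ee' _ _ exy));
      clear -ix xj xj' jt tyb axt; lia.
  have Ix := SI _ Sx.
  have yb : y = b.
    apply: f_inj; apply/eqP; rewrite eqn_leq; have /andP[ty ->] := tyb.
    rewrite leqNgt; apply/negP => yb.
    have Iy : I y by rewrite /I yb; clear -ty at_; lia.
    have Sy : S y by apply: connect_trans Sx (connect1 _); rewrite /within_rel Ix Iy.
    by have := tmax _ Sy; clear -ty; lia.
  subst y; rewrite eqxx andbT in nab.
  have fxa : f x != f a by rewrite inj_eq.
  have axb : f a < f x < f b by move: Ix; rewrite /I; clear -fxa; lia.
  exists x; split=> //.
  by apply: connect1; rewrite /within_rel exy; clear -axb; lia.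
- left; exists (f t).+1; first by rewrite ltnS at_.
  move=> x y exy /andP[ax xt] /andP[ty yb].
  move: nbad; rewrite negb_exists => /forallP/(_ x).
  rewrite negb_exists => /forallP/(_ y).
  rewrite /bad exy ax yb ty -ltnS xt /= negbK.
  by case/andP=> /eqP -> /eqP ->.
Qed.

Definition delete_vertex e v : rel V := fun x y => [&& x != v, y != v & e x y].

(** Contracting an edge at a vertex of degree 2 whose neighbours are [a] and [b]. *)
Definition suppress_vertex e v a b : rel V := fun x y =>
  delete_vertex e v x y || ((x == a) && (y == b) || (x == b) && (y == a)).

(** The new edge [ab] stands for the path through [v]. *)
Lemma suppress_vertex_tournament e t v a b : symmetric e -> e v a -> e v b ->
  outer_tournament e t -> outer_tournament (suppress_vertex e v a b) t.
Proof.
move=> e_sym va vb et; split; first exact: et.1.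
have via x y : (x == a) && (y == b) || (x == b) && (y == a) -> e x v /\ e v y.
  by case/orP=> /andP[/eqP -> /eqP ->]; rewrite !(e_sym _ v).
have edge x y : delete_vertex e v x y -> connect (within_rel (pred2 x y) e) x y.
  by case/and3P=> _ _ exy; apply: connect1; rewrite /within_rel /= !eqxx orbT.
have detour x y : (x == a) && (y == b) || (x == b) && (y == a) ->
    connect (within_rel (pred3 x y v) e) x y.
  case/via=> exv evy; apply: (@connect_trans _ _ v); apply: connect1;
    by rewrite /within_rel /= !eqxx !orbT ?exv ?evy.
move=> x y u w /orP[xy|xy] /orP[uw|uw] xu xw yu yw.
- by case/and3P: xy => _ _ exy; case/and3P: uw => _ _ euw; exact: et.2.
- apply: (link_connect et _ (edge _ _ xy) (detour _ _ uw)) => z /=.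
  case/and3P: xy => xv yv _.
  by case/orP=> /eqP ->; rewrite !negb_or ?xu ?xw ?xv ?yu ?yw ?yv.
- apply: (link_connect et _ (detour _ _ xy) (edge _ _ uw)) => z /=.
  case/and3P: uw => uv wv _.
  by case/or3P=> /eqP ->; rewrite negb_or ?xu ?xw ?yu ?yw // eq_sym uv eq_sym.
- exfalso; move: xu xw yu yw.
  by case/orP: xy => /andP[/eqP -> /eqP ->]; case/orP: uw => /andP[/eqP -> /eqP ->];
     rewrite !eqxx.
Qed.

Lemma delete_vertex_sym e v : symmetric e -> symmetric (delete_vertex e v).
Proof. by move=> e_sym x y; rewrite /delete_vertex e_sym andbCA. Qed.

Lemma suppress_vertex_sym e v a b :
  symmetric e -> symmetric (suppress_vertex e v a b).
Proof.
move=> e_sym x y; rewrite /suppress_vertex delete_vertex_sym //; congr (_ || _).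
by rewrite orbC ![(y == _) && _]andbC.
Qed.

(** The two neighbours of [v] split the circle into two arcs.  If one of them has a
    gap, [v] goes there.  Otherwise each arc contains an inner vertex of a path
    from [a] to [b], and these two vertices together with [v] form the side of
    size 3 of a K23. *)
Lemma noncrossing_order_of_suppressed e t v a b f0 : symmetric e -> irreflexive e ->
    outer_tournament e t -> e v a -> e v b ->
    (forall z, e v z -> z = a \/ z = b) -> injective f0 ->
    noncrossing (suppress_vertex e v a b) f0 -> f0 a < f0 b ->
  exists f, injective f /\ noncrossing e f.
Proof.
move=> e_sym e_irr et va vb vab f0_inj nc0 ab0.
have neq_adj x y : e x y -> x != y by apply: contraTneq => ->; rewrite e_irr.
have av : a != v by rewrite eq_sym neq_adj.
have bv : b != v by rewrite eq_sym neq_adj.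
have del_sym := delete_vertex_sym v e_sym.
pose e' := suppress_vertex e v a b.
have e'_sym : symmetric e' by exact: suppress_vertex_sym.
have e'ab : e' a b by rewrite /e' /suppress_vertex !eqxx orbT.
have de' : subrel (delete_vertex e v) e' by move=> x y; rewrite /e' /suppress_vertex => ->.
have de'' x y : x != v -> y != v -> e x y -> e' x y.
  by move=> xv yv exy'; apply: de'; rewrite /delete_vertex xv yv.
have del_cut (f : V -> nat) p c d :
    (forall x y, delete_vertex e v x y ->
     f c <= f x < p -> p <= f y <= f d -> x = c /\ y = d) ->
    (forall x y, x != v -> y != v -> e x y -> f c <= f x < p -> p <= f y <= f d ->
     x = c /\ y = d).
  by move=> H x y xv yv exy'; apply: H; rewrite /delete_vertex xv yv.
have [[p pab cut]|[z [zab dzb az zb]]] := cut_or_bridge f0_inj del_sym de' nc0 ab0.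
  exists (insert_order f0 v p); split; first exact: insert_order_inj.
  exact: (noncrossing_insert_between e_sym e'ab pab av bv vab de'' nc0
    (del_cut _ _ _ _ cut)).
(* rotating makes the outer arc from [b] to [a] the inner one *)
pose f1 := rotate_order f0 (f0 b).
have f1_inj : injective f1 by exact: rotate_order_inj.
have nc1 : noncrossing e' f1 by exact: rotate_order_noncrossing.
have f1b : f1 b = f0 b by rewrite /f1 /rotate_order ltnn.
have f1a : f1 a = f0 a + (\max_w f0 w).+1 by rewrite /f1 /rotate_order ab0.
have ba1 : f1 b < f1 a.
  by rewrite f1a f1b; have := leq_bigmax (F := f0) b; clear; lia.
have e'ba : e' b a by rewrite e'_sym.
have vba w : e v w -> w = b \/ w = a by case/vab; auto.
have [[p pba cut]|[z' [zba' dza bz' za']]] := cut_or_bridge f1_inj del_sym de' nc1 ba1.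
  exists (insert_order f1 v p); split; first exact: insert_order_inj.
  exact: (noncrossing_insert_between e_sym e'ba pba bv av vba de'' nc1
    (del_cut _ _ _ _ cut)).

have zv : z != v by case/and3P: dzb.
have z'v : z' != v by case/and3P: dza.
have bound w : f1 w = f0 w /\ f0 b <= f0 w \/
    f1 w = f0 w + (\max_w f0 w).+1 /\ f0 w < f0 b.
  by rewrite /f1 /rotate_order; case: ltnP; auto.
have mx w : f0 w <= \max_w f0 w by exact: (leq_bigmax (F := f0)).
pose off A : pred V := fun x => A x && (x != v).
have offP A x y : connect (within_rel A (delete_vertex e v)) x y ->
    connect (within_rel (off A) e) x y.
  apply: connect_within_sub => c d Ac Ad /and3P[cv dv ecd].
  by rewrite /off Ac Ad cv dv.
have offP' A x y : connect (within_rel A (delete_vertex e v)) x y ->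
    connect (within_rel (off A) e) y x.
  by move=> H; rewrite connect_within_sym //; exact: offP.
have edge x : e v x -> connect (within_rel (pred2 x v) e) x v.
  by move=> vx; apply: connect1; rewrite /within_rel /= !eqxx orbT e_sym.
have offpair A x : ~~ A x -> forall w, pred2 x v w -> ~~ off A w.
  by move=> nA w /orP[]/eqP ->; rewrite /off ?eqxx ?andbF // (negPf nA).
have offpair' A x : ~~ A x -> forall w, off A w -> ~~ pred2 x v w.
  by move=> nA w Aw; apply: contraL Aw; exact: offpair.
exfalso; apply: (@tournament_no_K23 _ e t et a b v z z').
- by rewrite eq_sym.
- by rewrite eq_sym.
- apply: contraTneq zba' => <-; have := bound z; have := mx z.
  by clear -zab f1a f1b; lia.
- by apply: (link_connect et _ (edge _ va) (offP' _ _ _ zb)); apply: offpair; clear; lia.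
- by apply: (link_connect et _ (offP _ _ _ az) (edge _ vb)); apply: offpair'; clear; lia.
- by apply: (link_connect et _ (edge _ va) (offP _ _ _ bz')); apply: offpair; clear; lia.
- by apply: (link_connect et _ (offP' _ _ _ za') (edge _ vb)); apply: offpair'; clear; lia.
- apply: (link_connect et _ (offP _ _ _ az) (offP _ _ _ bz')) => w.
  move=> /andP[w1 _]; rewrite /off negb_and; apply/orP; left.
  by have := bound w; clear -w1 f1a f1b; lia.
- apply: (link_connect et _ (offP' _ _ _ za') (offP' _ _ _ zb)) => w.
  move=> /andP[w1 _]; rewrite /off negb_and; apply/orP; left.
  by have := bound w; clear -w1 f1a f1b; lia.
Qed.

(** Vertices are not removed but isolated, so that the vertex type stays the same;
    the induction is on the number of non-isolated vertices. *)
Lemma noncrossing_order e t : symmetric e -> irreflexive e ->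
  outer_tournament e t -> exists f, injective f /\ noncrossing e f.
Proof.
have [k] := ubnP #|[pred x | [exists y, e x y]]|.
elim: k e => [//|k IH] e ek e_sym e_irr et.
have [/existsP[x0 /existsP[y0 exy]]|noedge] := boolP [exists x, exists y, e x y]; last first.
  exists (fun x => enum_rank x : nat); split; first by move=> x y /val_inj/enum_rank_inj.
  move=> x y u v exy; exfalso; move/negP: noedge; apply.
  by apply/existsP; exists x; apply/existsP; exists y.
have [v [a [b [va vab]]]] := low_degree_vertex e_sym e_irr et exy.
have neq_adj x y : e x y -> x != y by apply: contraTneq => ->; rewrite e_irr.
have decr e' : (forall x y, e' x y -> x != v /\ exists z, e x z) ->
    #|[pred x | [exists y, e' x y]]| < k.
  move=> e'P; apply: leq_trans (_ : #|[pred x | [exists y, e x y]]| <= k); last by [].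
  apply: proper_card; apply/properP; split.
    apply/fintype.subsetP => x; rewrite !inE => /existsP[y /e'P[_ [z exz]]].
    by apply/existsP; exists z.
  exists v; rewrite !inE; first by apply/existsP; exists a.
  by apply/existsP => -[y /e'P[]]; rewrite eqxx.
have del_sym := delete_vertex_sym v e_sym.
have [/andP[vb ab]|leaf] := boolP (e v b && (a != b)); last first.
  have va' z : e v z -> z = a.
    move=> vz; case: (vab z vz) => // zb; subst z.
    by move: leaf; rewrite vz /= negbK => /eqP ->.
  have [||||f [f_inj nc]] := IH (delete_vertex e v).
  - by apply: decr => x y /and3P[xv _ exy']; split=> //; exists y.
  - exact: del_sym.
  - by move=> x; rewrite /delete_vertex e_irr !andbF.
  - split; first exact: et.1.
    by move=> x y u w /and3P[_ _ exy'] /and3P[_ _ euw]; exact: et.2.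
  exists (insert_order f v (f a).+1); split; first exact: insert_order_inj.
  exact: noncrossing_insert_leaf.
have av : a != v by rewrite eq_sym neq_adj.
have bv : b != v by rewrite eq_sym neq_adj.
pose e' := suppress_vertex e v a b.
have e'_sym : symmetric e' by exact: suppress_vertex_sym.
have [||||f0 [f0_inj nc0]] := IH e'.
- apply: decr => x y /orP[/and3P[xv _ exy']|]; first by split=> //; exists y.
  by case/orP=> /andP[/eqP -> _]; split=> //; exists v; rewrite e_sym.
- exact: e'_sym.
- move=> x; rewrite /e' /suppress_vertex /delete_vertex e_irr !andbF /=.
  by apply/negP; case/orP=> /andP[/eqP E1 /eqP E2]; move: ab; rewrite -E1 -E2 eqxx.
- exact: suppress_vertex_tournament.
have [ab0|ba0|E] := ltngtP (f0 a) (f0 b).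
- exact: (noncrossing_order_of_suppressed e_sym e_irr et va vb vab f0_inj nc0 ab0).
- apply: (noncrossing_order_of_suppressed e_sym e_irr et vb va _ f0_inj _ ba0).
    by move=> z /vab[]; auto.
  apply: noncrossing_sub nc0 => x y; rewrite /e' /suppress_vertex.
  by rewrite [X in _ || X]orbC.
- by move: ab; rewrite (f0_inj _ _ E) eqxx.
Qed.

End Orders.

(** * Degree monotone paths in triangulated polygons *)

(** A bijection with an initial segment of [nat], with a total inverse, so that
    positions can be computed with freely. *)
Record labelling (V : finType) (f : V -> nat) (at_ : nat -> V) : Prop := Labelling {
  label_lt : forall x, f x < #|V|;
  labelK : cancel f at_;
  atK : forall i, i < #|V| -> f (at_ i) = i }.

Lemma labelling_exists (V : finType) (f : V -> nat) : injective f ->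
  (forall x, f x < #|V|) -> 0 < #|V| -> exists at_, labelling f at_.
Proof.
move=> f_inj f_lt /card_gt0P[x0 _].
pose g x := Ordinal (f_lt x).
have g_inj : injective g by move=> x y [/f_inj].
have [h gK hK] : bijective g by apply: inj_card_bij => //; rewrite card_ord.
exists (fun i => if insub i is Some o then h o else x0); split=> // [x|i lti].
  by rewrite insubT // => lt; rewrite -[RHS]gK; congr h; exact: val_inj.
by rewrite insubT /= -[RHS]/(val (Ordinal lti)) -(hK (Ordinal lti)).
Qed.

Lemma rank_label (V : finType) (f : V -> nat) : injective f ->
  exists r : V -> nat, [/\ injective r, forall x, r x < #|V|
    & forall x y, (r x < r y) = (f x < f y)].
Proof.
move=> f_inj; pose r x := #|[pred z | f z < f x]|.
have r_lt x y : f x < f y -> r x < r y.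
  move=> xy; apply: proper_card; apply/properP; split.
    by apply/fintype.subsetP => z; rewrite !inE => /ltn_trans; apply.
  by exists x; rewrite !inE ?ltnn.
have r_mono x y : (r x < r y) = (f x < f y).
  case: (ltngtP (f x) (f y)) => [/r_lt //|/r_lt/ltnW|/f_inj ->]; last by rewrite ltnn.
  by rewrite leqNgt => /negPf.
exists r; split=> // [x y E|x].
  by apply: f_inj; apply/eqP; case: ltngtP => //; rewrite -r_mono E ltnn.
apply: proper_card; apply/properP; split; first exact/fintype.subsetP.
by exists x; rewrite !inE // ltnn.
Qed.

(** Among noncrossing orders, this says that the polygon is triangulated.  It forces
    consecutive vertices, and also the first and the last one, to be adjacent,
    since nothing could cross such a pair. *)
Definition crossed (V : finType) (e : rel V) (f : V -> nat) :=
  forall x y, f x < f y -> ~~ e x y ->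
    exists u v, [/\ e u v, f x < f u < f y & f v < f x \/ f y < f v].

Section Polygon.
Variables (V : finType) (e : rel V) (f : V -> nat) (at_ : nat -> V).
Hypotheses (e_sym : symmetric e) (e_irr : irreflexive e).
Hypothesis lab : labelling f at_.
Let n := #|V|.
Let E i j := e (at_ i) (at_ j).

Let Esym i j : E i j = E j i. Proof. exact: e_sym. Qed.

Section Hamiltonian.
Hypothesis E_succ : forall i, i.+1 < n -> E i i.+1.
Hypothesis E_wrap : 1 < n -> E 0 n.-1.

Lemma interval_connect p q : p <= q < n ->
  connect (within_rel (fun x => p <= f x <= q) e) (at_ p) (at_ q).
Proof.
case/andP; elim: q => [|q IH]; first by rewrite leqn0 => /eqP ->.
rewrite leq_eqVlt => /predU1P[-> //|pq] qn.
apply: (@connect_trans _ _ (at_ q)).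
  apply: connect_within_sub (IH pq (ltnW qn)) => x y.
  by move=> /andP[-> xq] /andP[-> yq] ->; rewrite !leqW.
have qn' : q < n := ltnW qn.
apply: connect1; rewrite /within_rel [e _ _]E_succ // !(atK lab) //.
by clear -pq; lia.
Qed.

(** Crossing chords and the four arcs of the Hamiltonian cycle between their ends
    form a subdivision of K4. *)
Lemma hamiltonian_noncrossing t : outer_tournament e t -> noncrossing e f.
Proof.
move=> et x y u v exy euv xu uy yv.
have vn := label_lt lab v.
have neq a b : f a < f b -> a != b by apply: contraTneq => ->; rewrite ltnn.
have seg a b : f a <= f b -> connect (within_rel (fun z => f a <= f z <= f b) e) a b.
  move=> ab; have := @interval_connect (f a) (f b).
  by rewrite !(labelK lab); apply; rewrite ab (label_lt lab).
apply: (@tournament_no_K4 _ e t et x u y v); try by apply: neq; clear -xu uy yv; lia.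
- apply: (link_connect et _ (seg x u _) (seg y v _)); by clear -xu uy yv; lia.
- apply: (link_connect et (B := fun z => (f v <= f z) || (f z <= f x)) _ (seg u y _)).
  + by move=> z; clear -xu uy yv; lia.
  + by clear -uy; lia.
  + have n1 : 1 < n by move: vn; rewrite -/n; clear -xu uy yv; lia.
    have n0 : f (at_ 0) = 0 by apply: (atK lab); exact: ltnW.
    have nl : f (at_ n.-1) = n.-1 by apply: (atK lab); rewrite -/n; clear -n1; lia.
    have vlast : f v <= f (at_ n.-1) by move: vn; rewrite nl -/n; clear; lia.
    have x0 : f (at_ 0) <= f x by rewrite n0.
    apply: (@connect_trans _ _ (at_ n.-1)).
      by apply: connect_within_sub (seg _ _ vlast) => a b /andP[-> _] /andP[-> _] ->.
    apply: (@connect_trans _ _ (at_ 0)).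
      apply: connect1; rewrite /within_rel vlast x0 orbT /=.
      by rewrite -/(E _ _) Esym E_wrap.
    by apply: connect_within_sub (seg _ _ x0) => a b /andP[_ ->] /andP[_ ->] ->; rewrite !orbT.
- by apply: et.2 => //; rewrite 1?[y == u]eq_sym; apply: neq; clear -xu uy yv; lia.
Qed.

End Hamiltonian.

Hypothesis nc : noncrossing e f.
Hypothesis cr : crossed e f.

Let E_nc i j k l : E i j -> E k l -> i < k < j -> j < l < n -> False.
Proof.
move=> Eij Ekl ikj jl; apply: (nc Eij Ekl); rewrite !(atK lab) // -/n; clear -ikj jl; lia.
Qed.

Let E_cr i j : i < j < n -> ~~ E i j ->
  exists k l, [/\ E k l, i < k < j, l < n & l < i \/ j < l].
Proof.
move=> ij nE; have [jn [li lj]] : j < n /\ i < n /\ i < j by clear -ij; lia.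
have [|u [v [euv xuy vxy]]] := cr _ nE; first by rewrite !(atK lab).
exists (f u), (f v); move: xuy vxy; rewrite !(atK lab) //.
by move=> ? ?; split=> //; rewrite ?/E ?(labelK lab) //; exact: label_lt lab _.
Qed.

Lemma triangulation_succ i : i.+1 < n -> E i i.+1.
Proof.
move=> lt; apply: contraT => /E_cr[|k [l [_ H _ _]]]; first by rewrite ltnSn.
by clear -H; lia.
Qed.

Lemma triangulation_wrap : 1 < n -> E 0 n.-1.
Proof.
move=> lt; apply: contraT => /E_cr[|k [l [_ _ H H']]]; first by clear -lt; lia.
by clear -H H'; lia.
Qed.

Let Eirr i j : E i j -> i <> j. Proof. by rewrite /E => H ij; rewrite ij e_irr in H. Qed.

(** The largest neighbour [v] of [p] before [q] works: an edge crossing the pair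
    [v], [q] cannot cross [pv] or [pq], so it ends at [p] and contradicts the
    choice of [v]. *)
Lemma apex p q : E p q -> p.+1 < q < n -> exists2 v, p < v < q & E p v /\ E v q.
Proof.
move=> Epq pq.
pose P v := (p < v < q) && E p v.
have exP : exists v, P v.
  exists p.+1; rewrite /P triangulation_succ; last by clear -pq; lia.
  by clear -pq; lia.
have boundP v : P v -> v <= q by move=> /andP[H _]; clear -H; lia.
have [v /andP[pvq Epv] vmax] := ex_maxnP exP boundP.
exists v => //; split=> //; apply: contraT => /E_cr[|k [l [Ekl vkq ln side]]].
  by clear -pvq pq; lia.
have [lp|[pl|lq]] : l < p \/ p <= l \/ q < l by clear; lia.
- case: (@E_nc l k p q); rewrite // 1?Esym //; clear -pq vkq pvq lp; lia.
- have [lv|lq] := side; last first.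
    by case: (@E_nc p q k l); rewrite //; clear -pq vkq pvq lq ln; lia.
  have [lp|pl'] := eqVneq l p.
    have : P k by rewrite lp in Ekl; rewrite /P Esym Ekl; clear -vkq pvq; lia.
    by move/vmax; clear -vkq; lia.
  by case: (@E_nc p v l k); rewrite // 1?Esym //; clear -pl pl' lv vkq pq; lia.
- by case: (@E_nc p q k l); rewrite //; clear -pq vkq pvq lq ln; lia.
Qed.

Let dg i := deg e (at_ i).

Lemma deg_ge (s : seq nat) i : uniq s -> all (fun j => (j < n) && E i j) s ->
  size s <= dg i.
Proof.
move=> us /allP sE.
have us' : uniq (map at_ s).
  rewrite map_inj_in_uniq // => j k /sE/andP[jn _] /sE/andP[kn _] jk.
  by rewrite -(atK lab jn) -(atK lab kn) jk.
rewrite -(size_map at_) -(card_uniqP us'); apply: subset_leq_card.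
by apply/fintype.subsetP => _ /mapP[j /sE/andP[_ Eij] ->].
Qed.

Lemma deg_le (s : seq nat) i : (forall j, j < n -> E i j -> j \in s) -> dg i <= size s.
Proof.
move=> sE; rewrite -(size_map at_); apply: leq_trans (card_size _).
apply: subset_leq_card; apply/fintype.subsetP => y; rewrite inE => ey.
by rewrite -(labelK lab y) map_f // sE ?(label_lt lab) // /E (labelK lab).
Qed.

Lemma nbr_between p q w j : E p q -> p < w < q -> q < n -> j < n -> E w j ->
  p <= j <= q.
Proof.
move=> Epq pwq qn jn Ewj; case: (leqP p j) => pj; last first.
  by case: (@E_nc j w p q); rewrite // 1?Esym //; clear -pj pwq qn; lia.
case: (leqP j q) => // qj.
by case: (@E_nc p q w j); rewrite // ; clear -pwq jn qj; lia.
Qed.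

Lemma ear_deg p : E p p.+2 -> p.+2 < n -> dg p.+1 <= 2.
Proof.
move=> Ep pn; apply: (@deg_le [:: p; p.+2]) => j jn Ej.
have := nbr_between (w := p.+1) Ep _ pn jn Ej; have := Eirr Ej; rewrite !inE; clear; lia.
Qed.

(** Descend through the triangles until a chord cuts off a single vertex. *)
Lemma ear_exists p q : E p q -> p.+1 < q < n -> exists2 w, p < w < q & dg w <= 2.
Proof.
have [d] := ubnP (q - p); elim: d p q => // d IH p q dpq Epq pq.
have [v pvq [Epv Evq]] := apex Epq pq.
have [pv|vp] := ltnP p.+1 v.
  have [||w pwv w2] := IH p v _ Epv; try (clear -dpq pvq pq pv; lia).
  by exists w => //; clear -pvq pwv; lia.
have [vq|qv] := ltnP v.+1 q.
  have [||w pwv w2] := IH v q _ Evq; try (clear -dpq pvq pq vq; lia).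
  by exists w => //; clear -pvq pwv; lia.
have vE : v = p.+1 by clear -pvq vp; lia.
have qE : q = p.+2 by clear -pvq qv vE; lia.
exists p.+1; first by rewrite qE; clear; lia.
by apply: ear_deg; rewrite -qE //; clear -pq; lia.
Qed.

(** Look at the triangle on the edge joining the first and the last vertex: each
    of its other two sides either cuts off vertices, hence an ear, or makes the
    first or the last vertex an ear. *)
Lemma two_ears : 4 <= n -> exists i j, [/\ i < j < n, dg i <= 2 & dg j <= 2].
Proof.
move=> n4.
have E0 : E 0 n.-1 by apply: triangulation_wrap; clear -n4; lia.
have [|v v0 [E0v Evl]] := apex E0; first by clear -n4; lia.
have [v1|v1] := ltnP 1 v.
  have [|i iv i2] := ear_exists E0v; first by clear -v0 v1; lia.
  have [vl|vl] := ltnP v.+1 n.-1.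
    have [|j jv j2] := ear_exists Evl; first by clear -vl; lia.
    by exists i, j; split=> //; clear -iv jv; lia.
  exists i, n.-1; split=> //; first by clear -iv v0; lia.
  apply: (@deg_le [:: 0; v]) => j jn; rewrite Esym => Ej; have := Eirr Ej.
  rewrite !inE => jl; have [//|j0] := eqVneq j 0.
  apply: contraT => jv; case: (@E_nc 0 v j n.-1) => //; clear -n4 j0 jv jl jn vl v0; lia.
have vE : v = 1 by clear -v0 v1; lia.
have [|j jv j2] := ear_exists Evl; first by rewrite vE; clear -n4; lia.
exists 0, j; split=> //; first by clear -jv; lia.
apply: (@deg_le [:: 1; n.-1]) => k kn Ek; have := Eirr Ek.
rewrite !inE => k0; apply: contraT => kl.
case: (@E_nc 0 k v n.-1) => //; clear -vE n4 k0 kl kn; lia.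
Qed.

Let pred_nbr i := if i is 0 then n.-1 else i.-1.
Let succ_nbr i := if i.+1 < n then i.+1 else 0.

Lemma cycle_nbrs i : 3 <= n -> i < n ->
  [/\ E i (pred_nbr i), E i (succ_nbr i), pred_nbr i < n, succ_nbr i < n
    & [/\ pred_nbr i != succ_nbr i, pred_nbr i = i.-1 \/ i = 0 /\ pred_nbr i = n.-1 &
       succ_nbr i = i.+1 \/ i = n.-1 /\ succ_nbr i = 0]].
Proof.
move=> n3 ilt.
have wrap : E 0 n.-1 by apply: triangulation_wrap; clear -n3; lia.
have predP : E i (pred_nbr i).
  rewrite /pred_nbr; case: i ilt => [//|i] ilt.
  by rewrite Esym; exact: triangulation_succ.
have succP : E i (succ_nbr i).
  rewrite /succ_nbr; case: ltnP => H; first exact: triangulation_succ.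
  have -> : i = n.-1 by clear -ilt H; lia.
  by rewrite Esym.
have pE : pred_nbr i = i.-1 \/ i = 0 /\ pred_nbr i = n.-1.
  by rewrite /pred_nbr; case: (i); auto.
have sE : succ_nbr i = i.+1 /\ i.+1 < n \/ i = n.-1 /\ succ_nbr i = 0.
  by rewrite /succ_nbr; case: ltnP; auto; clear -ilt; lia.
by split=> //; [..|split] => //; clear -pE sE ilt n3; lia.
Qed.

Lemma deg2_nbr i j : 3 <= n -> i < n -> j < n -> dg i <= 2 -> E i j ->
  j = pred_nbr i \/ j = succ_nbr i.
Proof.
move=> n3 ilt jn d2 Eij.
have [Ep Es pn sn [ps _ _]] := cycle_nbrs n3 ilt.
have [->|jp] := eqVneq j (pred_nbr i); first by left.
have [->|js] := eqVneq j (succ_nbr i); first by right.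
have := @deg_ge [:: j; pred_nbr i; succ_nbr i] i.
rewrite /= !inE negb_or jp js ps Ep Es pn sn Eij jn => /(_ isT isT).
by move=> d3; have := leq_trans d3 d2.
Qed.

(** If adjacent [i] and [j] both had degree 2, then [j] and the other neighbour of
    [i], or [i] and the other neighbour of [j], would not be adjacent, and any edge
    crossing that pair would be a third edge at [i] or [j]. *)
Lemma deg2_nonadjacent i j : 4 <= n -> i < j < n -> dg i <= 2 -> dg j <= 2 -> ~~ E i j.
Proof.
move=> n4 ij di dj; apply/negP => Eij.
have [n3 [ilt jlt]] : 3 <= n /\ i < n /\ j < n by clear -n4 ij; lia.
have Ni k : k < n -> E i k -> k = pred_nbr i \/ k = succ_nbr i by move=> kn; exact: deg2_nbr.
have Nj k : k < n -> E j k -> k = pred_nbr j \/ k = succ_nbr j by move=> kn; exact: deg2_nbr.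
have [_ _ _ _ [_ pi si]] := cycle_nbrs n3 ilt.
have [_ _ _ _ [_ pj sj]] := cycle_nbrs n3 jlt.
have ji := Ni j jlt Eij.
have [jS|[i0 jl]] : j = i.+1 \/ i = 0 /\ j = n.-1 by clear -ji pi si ij n4; lia.
- have [i0|ipos] := posnP i.
    have nE : ~~ E 0 2.
      by apply/negP; rewrite -i0 => /Ni H; have := H _; clear -H n4 pi si i0; lia.
    have [|k [l [Ekl k1 ln l2]]] := E_cr _ nE; first by clear -n4; lia.
    have kj : k = j by clear -k1 jS i0; lia.
    rewrite kj in Ekl; have := Nj l ln Ekl; clear -n4 pj sj jS i0 l2 ln; lia.
  have nE : ~~ E i.-1 i.+1.
    apply/negP; rewrite Esym -jS => /Nj H; have := H _; clear -H n4 pj sj jS ipos ij; lia.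
  have [|k [l [Ekl k1 ln l2]]] := E_cr _ nE; first by clear -ij jS ipos; lia.
  have ki : k = i by clear -k1; lia.
  rewrite ki in Ekl; have := Ni l ln Ekl; clear -n4 pi si ipos ij l2 ln; lia.
- have nE : ~~ E 0 n.-2.
    by apply/negP; rewrite -i0 => /Ni H; have := H _; clear -H n4 pi si i0; lia.
  have [|k [l [Ekl k1 ln l2]]] := E_cr _ nE; first by clear -n4; lia.
  have lj : l = j by clear -l2 ln jl; lia.
  have kn : k < n by clear -k1; lia.
  rewrite lj Esym in Ekl; have := Nj k kn Ekl; clear -n4 pj sj jl k1; lia.
Qed.

Lemma adjacent_deg2 x y : 4 <= n -> e x y -> deg e x <= 2 -> deg e y <= 2 -> False.
Proof.
move=> n4; rewrite -(labelK lab x) -(labelK lab y).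
have xn := label_lt lab x; have yn := label_lt lab y; rewrite -/(E _ _) -/(dg _) -/(dg _).
case: (ltngtP (f x) (f y)) => [xy|yx|->] Exy dx dy; last by case: (Eirr Exy).
  by move: Exy; apply/negP/deg2_nonadjacent; rewrite ?xy.
by move: Exy; rewrite Esym; apply/negP/deg2_nonadjacent; rewrite ?yx.
Qed.

Lemma no_spanning_increasing_path s : 4 <= n -> uniq s -> size s = n -> sorted e s ->
  sorted (fun x y => deg e x <= deg e y) s -> False.
Proof.
move=> n4 us sn es ds.
have [i [j [ij di dj]]] := two_ears n4.
have mem z : z \in s.
  have [||_ ->] := @uniq_min_size _ s (enum V) us; last by rewrite mem_enum.
    by move=> w _; rewrite mem_enum.
  by rewrite -cardE sn.
have neq : at_ i != at_ j.
  apply/eqP => /(congr1 f); rewrite !(atK lab) //; rewrite -?/n; clear -ij; lia.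
case: s us sn es ds mem => [|x [|y r]] /=; try (clear -n4; lia).
move=> _ _ /andP[exy _] /andP[dxy dyr] mem.
have dy z : z != x -> deg e y <= deg e z.
  move=> zx; have := mem z; rewrite !inE (negPf zx) /= => /predU1P[-> //|zr].
  have trans : transitive (fun x y => deg e x <= deg e y).
    by move=> b a c; exact: leq_trans.
  by have /allP/(_ z zr) := order_path_min trans dyr.
have dy2 : deg e y <= 2.
  have [ix|ix] := eqVneq (at_ i) x; last exact: leq_trans (dy _ ix) di.
  by apply: leq_trans (dy _ _) dj; rewrite -ix eq_sym.
exact: adjacent_deg2 n4 exy (leq_trans dxy dy2) dy2.
Qed.

Lemma mp_lt_card : 4 <= n -> mp e <= n - 1.
Proof.
move=> n4; apply/bigmax_leqP => k /existsP[s /and3P[us es mono]].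
rewrite leqNgt; apply/negP => kn.
have sn : size s = n.
  have kn1 : k <= n by rewrite -ltnS; exact: ltn_ord.
  rewrite size_tuple; apply/eqP; rewrite eqn_leq kn1 /=.
  by move: kn; rewrite subn1; case: (n).
case/orP: mono => ds; first exact: (no_spanning_increasing_path n4 us sn es ds).
apply: (@no_spanning_increasing_path (rev s) n4); rewrite ?rev_uniq ?size_rev //.
  by rewrite rev_sorted (eq_sorted (e' := e)) // => x y; rewrite e_sym.
by rewrite rev_sorted.
Qed.

Lemma mp_ge4_of_path a b c d : uniq [:: a; b; c; d] -> e a b -> e b c -> e c d ->
  deg e a <= deg e b -> deg e b <= deg e c -> deg e c <= deg e d -> 4 <= mp e.
Proof.
move=> us ab bc cd dab dbc dcd.
have n4 : 4 < #|V|.+1 by rewrite ltnS -[4]/(size [:: a; b; c; d]) -(card_uniqP us) max_card.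
apply: (@leq_trans (Ordinal n4)) => //; apply: leq_bigmax_cond.
apply/existsP; exists [tuple a; b; c; d]; rewrite /degree_monotone_path us /=.
by rewrite ab bc cd dab dbc dcd.
Qed.

(** Descend to a shortest chord that still cuts off two vertices; the two other
    sides of its triangle then cut off at most one vertex each. *)
Lemma triangle_in_short_chord p q : E p q -> p.+2 < q < n ->
  exists p' v q', [/\ [/\ p' < v < q', q' < n & p'.+2 < q'],
    v <= p'.+2 /\ q' <= v.+2, E p' q', E p' v & E v q'].
Proof.
have [d] := ubnP (q - p); elim: d p q => // d IH p q dpq Epq pq.
have [|v pvq [Epv Evq]] := apex Epq; first by clear -pq; lia.
have [pv|vp] := ltnP p.+2 v.
  by apply: (IH p v) => //; clear -dpq pvq pq pv; lia.
have [vq|qv] := ltnP v.+2 q.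
  by apply: (IH v q) => //; clear -dpq pvq pq vq; lia.
have [pq2 qn] : p.+2 < q /\ q < n by clear -pq; lia.
exists p, v, q; split=> //; split=> //; clear -vp qv; lia.
Qed.

(** The short triangle [p], [v], [q] has an ear [w] on [pv] or on [vq], and it does
    not fill the polygon since there are at least six vertices; so [p] and [q]
    have a neighbour outside and their degrees are at least that of [v]. *)
Lemma mp_ge4 : 6 <= n -> 4 <= mp e.
Proof.
move=> n6; have n3 : 3 <= n by clear -n6; lia.
have E0 : E 0 n.-1 by apply: triangulation_wrap; clear -n6; lia.
have [|p [v [q [[pvq qn pq] [vp qv] Epq Epv Evq]]]] := triangle_in_short_chord E0.
  by clear -n6; lia.
have [pn vn] : p < n /\ v < n by clear -pvq qn; lia.
have [Epp _ ppn _ [_ pp _]] := cycle_nbrs n3 pn.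
have [_ Eqs _ qsn [_ _ qs]] := cycle_nbrs n3 qn.
have Eqp : E q p by rewrite Esym.
have Eqv : E q v by rewrite Esym.
have Evp : E v p by rewrite Esym.
(* [k] bounds the degree of [v] from above and those of [p], [q] from below *)
suff [w [wn [wp [wv wq]] [Ewv dw [k [dv dp dq]]]]] : exists w,
    [/\ w < n, [/\ w != p, w != v & w != q] & [/\ E w v, dg w <= dg v &
     exists k, [/\ dg v <= k, k <= dg p & k <= dg q]]].
  have at_neq i j : i < n -> j < n -> i != j -> at_ i != at_ j.
    move=> lti ltj; apply: contra_neq => /(congr1 f).
    by rewrite !(atK lab).
  have pq' : p != q by clear -pvq; lia.
  have vp' : v != p by clear -pvq; lia.
  have vq' : v != q by clear -pvq; lia.
  have [dpq|dqp] := leqP (dg p) (dg q).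
    apply: (@mp_ge4_of_path (at_ w) (at_ v) (at_ p) (at_ q)) => //.
      by rewrite /= !inE !negb_or !at_neq.
    exact: leq_trans dv dp.
  apply: (@mp_ge4_of_path (at_ w) (at_ v) (at_ q) (at_ p)) => //.
    by rewrite /= !inE !negb_or !at_neq // 1?eq_sym.
  - exact: leq_trans dv dq.
  - exact: ltnW.
have vdeg s : (forall j, p <= j <= q -> j != v -> j \in s) -> dg v <= size s.
  move=> H; apply: deg_le => j jn Ej; apply: H; first exact: nbr_between Epq pvq qn jn Ej.
  by have := Eirr Ej; clear; lia.
have [v2|v1] : v = p.+2 \/ v = p.+1 by clear -vp pvq; lia.
- have Epw : E p p.+1 by apply: triangulation_succ; clear -pvq qn; lia.
  have Ewv : E p.+1 v by rewrite v2; apply: triangulation_succ; clear -pvq qn v2; lia.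
  exists p.+1; split; [by clear -pvq qn; lia|by split; clear -pvq v2; lia|].
  split=> //.
    apply: leq_trans (_ : 2 <= _); first by apply: ear_deg; rewrite -v2.
    apply: (@deg_ge [:: p; q]); rewrite /= ?inE ?andbT; first by clear -pvq; lia.
    by rewrite Evp Evq pn qn.
  have [q2|q1] : q = v.+2 \/ q = v.+1 by clear -qv pvq; lia.
  + have Eqw : E q v.+1 by rewrite q2 Esym; apply: triangulation_succ; rewrite -q2.
    exists 4; split.
    * apply: (vdeg [:: p; p.+1; v.+1; q]) => j; rewrite !inE; clear -v2 q2; lia.
    * apply: (@deg_ge [:: p.+1; v; q; pred_nbr p]).
        by rewrite /= !inE; clear -pp pvq v2 q2 n6 qn; lia.
      by rewrite /= Epw Epv Epq Epp vn qn ppn !andbT; clear -pvq qn; lia.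
    * apply: (@deg_ge [:: p; v; v.+1; succ_nbr q]).
        by rewrite /= !inE; clear -qs pvq v2 q2 n6 qn; lia.
      by rewrite /= Eqp Eqv Eqw Eqs vn pn qsn !andbT; clear -q2 qn; lia.
  + exists 3; split.
    * apply: (vdeg [:: p; p.+1; q]) => j; rewrite !inE; clear -v2 q1; lia.
    * apply: (@deg_ge [:: p.+1; v; q]); first by rewrite /= !inE; clear -pvq v2; lia.
      by rewrite /= Epw Epv Epq vn qn !andbT; clear -pvq qn; lia.
    * apply: (@deg_ge [:: p; v; succ_nbr q]).
        by rewrite /= !inE; clear -qs pvq v2 q1 n6 qn; lia.
      by rewrite /= Eqp Eqv Eqs vn pn qsn.
- have q2 : q = v.+2 by clear -v1 pq qv; lia.
  have Ewv : E v.+1 v by rewrite Esym; apply: triangulation_succ; clear -q2 qn; lia.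
  have Eqw : E q v.+1 by rewrite q2 Esym; apply: triangulation_succ; rewrite -q2.
  exists v.+1; split; [by clear -q2 qn; lia|by split; clear -v1 q2; lia|].
  split=> //.
    apply: leq_trans (_ : 2 <= _); first by apply: ear_deg; rewrite -q2.
    apply: (@deg_ge [:: p; q]); rewrite /= ?inE ?andbT; first by clear -pvq; lia.
    by rewrite Evp Evq pn qn.
  exists 3; split.
  + apply: (vdeg [:: p; v.+1; q]) => j; rewrite !inE; clear -v1 q2; lia.
  + apply: (@deg_ge [:: v; q; pred_nbr p]).
      by rewrite /= !inE; clear -pp pvq v1 q2 n6 qn; lia.
    by rewrite /= Epv Epq Epp vn qn ppn.
  + apply: (@deg_ge [:: p; v; v.+1]); first by rewrite /= !inE; clear -v1; lia.
    by rewrite /= Eqp Eqv Eqw vn pn !andbT; clear -q2 qn; lia.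
Qed.

End Polygon.

(** * Irregular triangulated polygons without long monotone paths *)

(** The chords of one block, a polygon with vertices 0 to 8, and its side joining
    0 to 8.  Positions 0 and 8 are adjacent to the hub of the whole graph;
    position 7 is a second hub, adjacent to 0, 1, 3, 5, 6 and 8; positions 2, 4
    and 6 are ears. *)
Definition block_chord a b : bool :=
  (a, b) \in [:: (0, 7); (0, 8); (1, 3); (3, 5); (5, 7); (1, 7); (3, 7)].

(** Vertex 0 is the hub, vertex 1 an ear on the edge from 0 to 2, and the vertices
    from 2 on form blocks of nine. *)
Definition fan_up i j : bool :=
  [|| j == i.+1,
      [&& i == 0, 1 < j & ((j - 2) %% 9 == 0) || ((j - 2) %% 9 == 8)] |
      [&& 1 < i, 1 < j, (i - 2) %/ 9 == (j - 2) %/ 9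
        & block_chord ((i - 2) %% 9) ((j - 2) %% 9)]].

Definition fan_adj i j : bool := fan_up i j || fan_up j i.

(** Level 0 consists of the ears, of degree 2; level 1 has degrees 3 and 4, level 2
    degree 5, and level 3, the hubs, degree at least 6. *)
Definition fan_level i : nat :=
  if i == 0 then 3 else if i == 1 then 0 else
  nth 0 [:: 2; 1; 0; 2; 0; 1; 0; 3; 1] ((i - 2) %% 9).

Lemma block_chordP a b : block_chord a b ->
  a = 0 /\ b = 7 \/ a = 0 /\ b = 8 \/ a = 1 /\ b = 3 \/ a = 3 /\ b = 5 \/
  a = 5 /\ b = 7 \/ a = 1 /\ b = 7 \/ a = 3 /\ b = 7.
Proof. by rewrite /block_chord !inE !xpair_eqE; clear; lia. Qed.

Lemma fan_coord i : 1 < i -> exists t a, [/\ i = 2 + 9 * t + a & a < 9].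
Proof. by move=> i1; exists ((i - 2) %/ 9), ((i - 2) %% 9); split; lia. Qed.

Lemma fan_up_coord t a s b : a < 9 -> b < 9 ->
  fan_up (2 + 9 * t + a) (2 + 9 * s + b) =
  (2 + 9 * s + b == (2 + 9 * t + a).+1) || (t == s) && block_chord a b.
Proof.
move=> a9 b9; rewrite /fan_up.
have -> : ((2 + 9 * t + a - 2) %% 9 = a) by lia.
have -> : ((2 + 9 * s + b - 2) %% 9 = b) by lia.
have -> : ((2 + 9 * t + a - 2) %/ 9 = t) by lia.
have -> : ((2 + 9 * s + b - 2) %/ 9 = s) by lia.
have [-> ->] : 1 < 2 + 9 * t + a /\ 1 < 2 + 9 * s + b by lia.
by have -> : (2 + 9 * t + a == 0) = false by lia.
Qed.

Lemma fan_up0_coord s b : b < 9 ->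
  fan_up 0 (2 + 9 * s + b) = (b == 0) || (b == 8).
Proof.
move=> b9; rewrite /fan_up.
have -> : ((2 + 9 * s + b - 2) %% 9 = b) by lia.
have -> : 1 < 2 + 9 * s + b by lia.
have -> : (2 + 9 * s + b == 1) = false by lia.
by rewrite orbF.
Qed.

Lemma fan_up1 j : fan_up 1 j = (j == 2).
Proof. by rewrite /fan_up /= orbF. Qed.

Lemma fan_up_lt i j : fan_up i j -> i < j.
Proof.
case/or3P=> [/eqP ->//|/and3P[/eqP -> ]|/and4P[i1 j1 /eqP E /block_chordP H]].
  by move=> ? _; lia.
by lia.
Qed.

Lemma fan_noncrossing i j k l :
  fan_adj i j -> fan_adj k l -> i < k -> k < j -> j < l -> False.
Proof.
move=> + + ik kj jl.
case/orP=> [ij|/fan_up_lt]; last lia.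
case/orP=> [kl|/fan_up_lt]; last lia.
have [k1|k1] := leqP k 1.
  have k1' : k = 1 by lia.
  by move: kl; rewrite k1' fan_up1; lia.
have [s [b [kE b9]]] := fan_coord k1.
have [s' [d [lE d9]]] : exists s' d, l = 2 + 9 * s' + d /\ d < 9.
  by have [|s' [d [? ?]]] := @fan_coord l; [lia|exists s', d].
have [s2 [c [jE c9]]] : exists s2 c, j = 2 + 9 * s2 + c /\ c < 9.
  by have [|s2 [c [? ?]]] := @fan_coord j; [lia|exists s2, c].
subst k l j; move: kl; rewrite fan_up_coord // => /orP[|/andP[/eqP ss /block_chordP bd]].
  by lia.
have [i0|i0] := posnP i.
  by move: ij; rewrite i0 fan_up0_coord //; lia.
have [i1|i1] := leqP i 1.
  have i1' : i = 1 by lia.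
  by move: ij; rewrite i1' fan_up1; lia.
have [t [a [iE a9]]] := fan_coord i1.
subst i; move: ij; rewrite fan_up_coord // => /orP[|/andP[/eqP tt /block_chordP ac]].
  by lia.
have [? ?] : s = s2 /\ t = s by lia.
by lia.
Qed.

(* every non-adjacent pair of positions of a block is separated by an edge with
   one end strictly between them *)
(** A finite check on the nine positions of a block. *)
Lemma block_crossed a b : a < b < 9 -> ~~ block_chord a b -> b != a.+1 ->
  exists c d, [/\ a < c < b, d < 9, d < a \/ b < d &
     block_chord c d || block_chord d c].
Proof.
move=> ab nc ba.
have : all (fun a => all (fun b => [|| ~~ (a < b), block_chord a b, b == a.+1 |
   has (fun c => has (fun d => [&& a < c < b, (d < a) || (b < d) &
     block_chord c d || block_chord d c]) (iota 0 9)) (iota 0 9)]) (iota 0 9)) (iota 0 9) by [].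
move=> /allP/(_ a); rewrite mem_iota; have -> : 0 <= a < 0 + 9 by lia.
move=> /(_ isT)/allP/(_ b); rewrite mem_iota; have -> : 0 <= b < 0 + 9 by lia.
case/(_ isT)/or4P=> [|||]; try (clear -ab nc ba; lia).
case/hasP=> c _ /hasP[d]; rewrite mem_iota => d9 /and3P[acb side cd].
by exists c, d; split=> //; apply/orP.
Qed.

Lemma fan_level_lt4 i : fan_level i < 4.
Proof.
rewrite /fan_level; case: ifP => // _; case: ifP => // _.
have /allP : all (ltn^~ 4) [:: 2; 1; 0; 2; 0; 1; 0; 3; 1] by [].
by apply; apply: mem_nth; rewrite /= ltn_mod.
Qed.

Lemma fan_level_neq i j : fan_adj i j -> fan_level i != fan_level j.
Proof.
wlog: i j / fan_up i j => [W|ij _].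
  by case/orP=> ij; [|rewrite eq_sym]; apply: W => //; rewrite /fan_adj ij.
have [j1|j1] := leqP j 1.
  have [-> ->] : i = 0 /\ j = 1 by have := fan_up_lt ij; lia.
  by [].
have [s [b [jE b9]]] := fan_coord j1.
have level t a : a < 9 ->
    fan_level (2 + 9 * t + a) = nth 0 [:: 2; 1; 0; 2; 0; 1; 0; 3; 1] a.
  move=> a9; rewrite /fan_level.
  have [-> ->] : (2 + 9 * t + a == 0) = false /\ (2 + 9 * t + a == 1) = false by lia.
  by congr nth; lia.
move: ij; rewrite jE level //.
have [->|i0] := posnP i; first by rewrite fan_up0_coord // => /orP[]/eqP ->.
have [i1|i1] := leqP i 1.
  have -> : i = 1 by lia.
  rewrite fan_up1 => H; have -> // : b = 0 by lia.
have [t [a [-> a9]]] := fan_coord i1.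
rewrite fan_up_coord // level // => /orP[/eqP S|/andP[_ /block_chordP]].
  have [[-> ->] //|bS] : a = 8 /\ b = 0 \/ b = a.+1 by lia.
  have {}a9 : a < 8 by lia.
  rewrite bS; have : a \in iota 0 8 by rewrite mem_iota.
  by rewrite !inE => /or4P[|||/or4P[|||/orP[]]] /eqP ->.
by do 6!case=> [[-> -> //]|]; case=> -> ->.
Qed.

Section FanFamily.
Variable m : nat.
Let n := (9 * m).+2.

Lemma fan_adjC i j : fan_adj i j = fan_adj j i.
Proof. by rewrite /fan_adj orbC. Qed.

Lemma fan_adj_irr i : fan_adj i i = false.
Proof. by apply/negP; rewrite /fan_adj orbb => /fan_up_lt; rewrite ltnn. Qed.

Lemma fan_crossed i j : i < j < n -> ~~ fan_adj i j ->
  exists k l, [/\ fan_adj k l, i < k < j, l < n & l < i \/ j < l].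
Proof.
move=> /andP[ij jn]; rewrite /fan_adj negb_or => /andP[nij _].
have up k l : fan_up k l -> fan_adj k l by rewrite /fan_adj => ->.
have dn k l : fan_up k l -> fan_adj l k by rewrite /fan_adj => ->; rewrite orbT.
have hubA s : fan_up 0 (2 + 9 * s + 0) by rewrite fan_up0_coord.
have hubB s : fan_up 0 (2 + 9 * s + 8) by rewrite fan_up0_coord.
have AB s : fan_up (2 + 9 * s + 0) (2 + 9 * s + 8) by rewrite fan_up_coord // eqxx orbT.
have [j1|j1] := leqP j 1.
  have [i0 j1'] : i = 0 /\ j = 1 by lia.
  by move: nij; rewrite i0 j1'.
have [s [b [jE b9]]] := fan_coord j1.
have sm : s < m by lia.
have [i0|i0] := posnP i.
  move: nij; rewrite i0 jE fan_up0_coord // => nb.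
  exists (2 + 9 * s + 0), (2 + 9 * s + 8).
  split; [exact: (up _ _ (AB s))|lia|lia|right; lia].
have [i1|i1] := leqP i 1.
  have {i1}i1 : i = 1 by lia.
  move: nij; rewrite i1 fan_up1 => nj.
  by exists 2, 0; split; [exact: (dn _ _ (hubA 0))|lia|lia|left].
have [t [a [iE a9]]] := fan_coord i1.
move: nij; rewrite iE jE fan_up_coord // negb_or => /andP[njS nab].
have [ts|st] := ltnP t s.
  have [a0|a0] := posnP a.
    by exists (2 + 9 * t + 8), 0; split; [exact: (dn _ _ (hubB t))|lia|lia|left; lia].
  have [a8|a8] := eqVneq a 8.
    by exists (2 + 9 * t.+1 + 0), 0; split; [exact: (dn _ _ (hubA t.+1))|lia|lia|left; lia].
  exists (2 + 9 * t + 8), (2 + 9 * t + 0); split; [exact: (dn _ _ (AB t))|lia|lia|left; lia].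
have ts : t = s by lia.
rewrite ts eqxx in nab.
have [||c [d [acb d9 side cd]]] := block_crossed _ nab; try lia.
exists (2 + 9 * s + c), (2 + 9 * s + d); split; try lia.
have c9 : c < 9 by lia.
by rewrite /fan_adj !fan_up_coord // eqxx /= orbACA cd orbT.
Qed.

Definition fan : rel 'I_n := fun x y => fan_adj x y.

Let at_ i : 'I_n := inord i.

Lemma fan_labelling : labelling (fun x : 'I_n => x : nat) at_.
Proof.
split=> [x|x|i]; rewrite ?card_ord //; first exact: inord_val.
by move=> lti; rewrite /at_ inordK.
Qed.

Lemma fan_at i j : i < n -> j < n -> fan (at_ i) (at_ j) = fan_adj i j.
Proof. by move=> lti ltj; rewrite /fan /at_ !inordK. Qed.

Lemma fan_adj_block t a b : a < 9 -> b < 9 ->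
  [|| b == a.+1, a == b.+1, block_chord a b | block_chord b a] ->
  fan_adj (2 + 9 * t + a) (2 + 9 * t + b).
Proof.
move=> a9 b9; rewrite /fan_adj !fan_up_coord // eqxx /=.
by case/or4P=> [/eqP ->|/eqP ->|->|->]; rewrite ?addnS ?eqxx ?orbT.
Qed.

Lemma fan_adj_cases t a j : a < 9 -> fan_adj (2 + 9 * t + a) j ->
  j = 0 /\ (a = 0 \/ a = 8) \/ j = (2 + 9 * t + a).+1 \/ j.+1 = 2 + 9 * t + a \/
  exists b, j = 2 + 9 * t + b /\ (block_chord a b \/ block_chord b a).
Proof.
move=> a9.
have [j1|j1] := leqP j 1; last first.
  have [s [b [-> b9]]] := fan_coord j1.
  rewrite /fan_adj !fan_up_coord //.
  case/orP=> /orP[/eqP|/andP[/eqP E bc]].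
  - by auto.
  - by do 3!right; exists b; rewrite E; auto.
  - by auto.
  - by do 3!right; exists b; rewrite E; auto.
case/orP=> [/fan_up_lt|]; first lia.
have [j0|j0] := posnP j; first by rewrite j0 fan_up0_coord //; lia.
have -> : j = 1 by lia.
by rewrite fan_up1 => /eqP ->; auto.
Qed.

Let dge := @deg_ge 'I_n fan (fun x => x : nat) at_ fan_labelling.
Let dle := @deg_le 'I_n fan (fun x => x : nat) at_ fan_labelling.

Lemma fan_deg_le (s : seq nat) i : i < n ->
  (forall j, j < n -> fan_adj i j -> j \in s) -> deg fan (at_ i) <= size s.
Proof.
move=> lti H; apply: dle => j; rewrite card_ord => ltj.
by rewrite fan_at //; exact: H.
Qed.

Lemma fan_deg_ge (s : seq nat) i : i < n -> uniq s ->
  all (fun j => (j < n) && fan_adj i j) s -> size s <= deg fan (at_ i).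
Proof.
move=> lti us /allP sP; apply: dge => //; apply/allP => j /sP/andP[ltj ij].
by rewrite card_ord ltj fan_at.
Qed.

Hypothesis m3 : 3 <= m.

(** Three blocks are needed to give the hub degree at least 6. *)
Lemma fan_degree i : i < n ->
  nth 0 [:: 0; 3; 5; 6] (fan_level i) <= deg fan (at_ i) <=
  nth 0 [:: 2; 4; 5; n] (fan_level i).
Proof.
move=> lti.
have [i0|i0] := posnP i.
  subst i; apply/andP; split; last first.
    by have := max_card [pred y | fan (at_ 0) y]; rewrite card_ord.
  apply: (@fan_deg_ge [:: 1; 2; 10; 11; 19; 20]) => //=.
  have small j : j <= 20 -> j < n by rewrite /n; clear -m3; lia.
  by rewrite !small.
have [i1|i1] := leqP i 1.
  have {i1}i1 : i = 1 by lia.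
  subst i; rewrite /= ; apply: (@fan_deg_le [:: 0; 2]) => // j _.
  rewrite /fan_adj fan_up1 !inE => /orP[/eqP ->//|/fan_up_lt]; lia.
have [t [a [iE a9]]] := fan_coord i1.
have tm : t < m by move: lti; rewrite /n; lia.
have levE : fan_level i = nth 0 [:: 2; 1; 0; 2; 0; 1; 0; 3; 1] a.
  rewrite /fan_level; have [-> ->] : (i == 0) = false /\ (i == 1) = false by lia.
  by congr nth; rewrite iE; lia.
have nbrs j : fan_adj i j ->
    j = 0 /\ (a = 0 \/ a = 8) \/ j = i.+1 \/ j.+1 = i \/
    a = 0 /\ (j = i + 7 \/ j = i + 8) \/ a = 1 /\ (j = i + 2 \/ j = i + 6) \/
    a = 3 /\ (j = i + 2 \/ j = i + 4 \/ j + 2 = i) \/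
    a = 5 /\ (j = i + 2 \/ j + 2 = i) \/
    a = 7 /\ (j + 7 = i \/ j + 6 = i \/ j + 4 = i \/ j + 2 = i) \/ a = 8 /\ j + 8 = i.
  rewrite iE => /(fan_adj_cases a9); clear; move=> [|[|[|[b [-> []]]]]]; try lia;
    by case/block_chordP=> [[-> ->]|[[-> ->]|[[-> ->]|[[-> ->]|[[-> ->]|[[-> ->]|[-> ->]]]]]]];
       lia.
have blk b : b < 9 -> [|| b == a.+1, a == b.+1, block_chord a b | block_chord b a] ->
    (2 + 9 * t + b < n) && fan_adj i (2 + 9 * t + b).
  by move=> b9 H; rewrite iE fan_adj_block // andbT /n; clear -b9 tm; lia.
have hub : (a == 0) || (a == 8) -> fan_adj i 0.
  by move=> H; rewrite iE /fan_adj fan_up0_coord // H orbT.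
have prev : (i.-1 < n) && fan_adj i i.-1.
  by rewrite /fan_adj {2}/fan_up prednK // eqxx orbT; clear -lti; lia.
rewrite levE; move: nbrs blk hub iE {levE}.
have : a \in iota 0 9 by rewrite mem_iota.
rewrite !inE => /or4P[|||/or4P[|||/or3P[]]] /eqP -> nbrs blk hub iE; apply/andP; split=> //.
- apply: (@fan_deg_ge [:: 0; i.-1; 2 + 9 * t + 1; 2 + 9 * t + 7; 2 + 9 * t + 8]) => //.
    by rewrite /= !inE; clear -iE; lia.
  by rewrite /= !blk // hub // prev.
- apply: (@fan_deg_le [:: 0; i.-1; i.+1; i + 7; i + 8]) => // j _ /nbrs.
  by rewrite !inE; clear; lia.
- apply: (@fan_deg_ge [:: 2 + 9 * t + 0; 2 + 9 * t + 2; 2 + 9 * t + 3]) => //.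
    by rewrite /= !inE; clear; lia.
  by rewrite /= !blk.
- apply: (@fan_deg_le [:: i.-1; i.+1; i + 2; i + 6]) => // j _ /nbrs.
  by rewrite !inE; clear; lia.
- apply: (@fan_deg_le [:: i.-1; i.+1]) => // j _ /nbrs.
  by rewrite !inE; clear; lia.
- apply: (@fan_deg_ge [:: 2 + 9 * t + 1; 2 + 9 * t + 2; 2 + 9 * t + 4; 2 + 9 * t + 5;
      2 + 9 * t + 7]) => //.
    by rewrite /= !inE; clear; lia.
  by rewrite /= !blk.
- apply: (@fan_deg_le [:: i - 2; i.-1; i.+1; i + 2; i + 4]) => // j _ /nbrs.
  by rewrite !inE; clear; lia.
- apply: (@fan_deg_le [:: i.-1; i.+1]) => // j _ /nbrs.
  by rewrite !inE; clear; lia.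
- apply: (@fan_deg_ge [:: 2 + 9 * t + 3; 2 + 9 * t + 4; 2 + 9 * t + 6]) => //.
    by rewrite /= !inE; clear; lia.
  by rewrite /= !blk.
- apply: (@fan_deg_le [:: i - 2; i.-1; i.+1; i + 2]) => // j _ /nbrs.
  by rewrite !inE; clear; lia.
- apply: (@fan_deg_le [:: i.-1; i.+1]) => // j _ /nbrs.
  by rewrite !inE; clear; lia.
- apply: (@fan_deg_ge [:: 2 + 9 * t + 0; 2 + 9 * t + 1; 2 + 9 * t + 3; 2 + 9 * t + 5;
      2 + 9 * t + 6; 2 + 9 * t + 8]) => //.
    by rewrite /= !inE; clear; lia.
  by rewrite /= !blk.
- by have := max_card [pred y | fan (at_ i) y]; rewrite card_ord.
- apply: (@fan_deg_ge [:: 0; 2 + 9 * t + 0; 2 + 9 * t + 7]) => //.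
    by rewrite /= !inE; clear; lia.
  by rewrite /= !blk // hub.
- apply: (@fan_deg_le [:: 0; i - 8; i.-1; i.+1]) => // j _ /nbrs.
  by rewrite !inE; clear; lia.
Qed.

Lemma fan_level_deg (x y : 'I_n) : fan x y -> deg fan x <= deg fan y ->
  fan_level x < fan_level y.
Proof.
move=> xy; have := fan_degree (ltn_ord x); have := fan_degree (ltn_ord y).
rewrite /at_ !inord_val; have := fan_level_neq xy.
have := fan_level_lt4 x; have := fan_level_lt4 y.
move: (fan_level x) (fan_level y) => a b.
case: a => [|[|[|[|//]]]]; case: b => [|[|[|[|//]]]] //=; clear; lia.
Qed.

Lemma fan_irregular x y : ~~ regular_edge fan x y.
Proof.
apply/negP => /andP[xy /eqP dxy]; have yx : fan y x by rewrite /fan fan_adjC.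
have := fan_level_deg xy; have := fan_level_deg yx; rewrite dxy leqnn; lia.
Qed.

Lemma increasing_path_le4 s : sorted fan s ->
  sorted (fun x y => deg fan x <= deg fan y) s -> size s <= 4.
Proof.
move=> es ds; have ls : sorted ltn (map (fun x : 'I_n => fan_level x) s).
  case: s es ds => // x s; elim: s x => //= y s IH x /andP[xy es] /andP[dxy ds].
  by rewrite fan_level_deg //=; exact: IH.
rewrite -(size_map (fun x : 'I_n => fan_level x)) -(size_iota 0 4).
apply: uniq_leq_size; first exact: sorted_uniq ltn_trans ltnn _ ls.
by move=> _ /mapP[x _ ->]; rewrite mem_iota fan_level_lt4.
Qed.

Lemma mp_fan_le4 : mp fan <= 4.
Proof.
apply/bigmax_leqP => k /existsP[s /and3P[us es mono]].
rewrite -(size_tuple s).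
case/orP: mono => ds; first exact: increasing_path_le4.
rewrite -size_rev; apply: increasing_path_le4; last by rewrite rev_sorted.
by rewrite rev_sorted (eq_sorted (e' := fan)) // => x y; rewrite /fan fan_adjC.
Qed.

End FanFamily.

(** * Parities of plane curves *)

Section PlaneCrossings.
Variable R : realType.
Local Open Scope classical_set_scope.
Local Open Scope ring_scope.
Implicit Types (d z p : R * R) (g : R -> R * R).

(** The half plane above the horizontal axis, closed on the right and open on the
    left: with this choice exactly one of [d] and [- d] is in it if [d] is
    nonzero, also on the axis. *)
Definition upper d : bool := (0 < d.2) || ((d.2 == 0) && (0 < d.1)).

(** For [d] and [d'] near each other compared with their norms, this says whether
    the segment between them crosses the positive horizontal half-axis. *)
Definition ray_cross d d' : bool := (upper d (+) upper d') && (0 < d.1).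

Lemma upperN d : d != 0 -> upper (- d) = ~~ upper d.
Proof.
case: d => x y; rewrite /upper /= -[0]/(0, 0) xpair_eqE !oppr_gt0 oppr_eq0.
by case: (ltrgtP y 0) => //= _; case: (ltrgtP x 0).
Qed.

Lemma norm_pairE d : `|d| = Num.max `|d.1| `|d.2|.
Proof. by []. Qed.

Lemma norm_pair_lt d (r : R) : (`|d| < r) = (`|d.1| < r) && (`|d.2| < r).
Proof. by rewrite norm_pairE gt_max. Qed.

(** A ball that misses the origin is contained in one of four half planes (norms
    are maxima of coordinates), and there crossing the ray is a coboundary; hence
    it sums to zero over small closed polygons. *)
Lemma ray_cross_potential d0 (r : R) : 0 < r -> r <= `|d0| ->
  exists h : R * R -> bool, forall d d', `|d - d0| < r -> `|d' - d0| < r ->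
    ray_cross d d' = h d (+) h d'.
Proof.
move=> r0; rewrite norm_pairE le_max => /orP[] rd.
- exists (fun d => upper d && (0 < d0.1)) => d d'.
  rewrite !norm_pair_lt /= => /andP[hd _] /andP[hd' _]; rewrite /ray_cross.
  have -> : (0 < d.1) = (0 < d0.1).
    by apply/idP/idP; move: rd hd; rewrite ler_normr ltr_norml; lra.
  by case: (0 < d0.1); rewrite ?andbT ?andbF.
- exists (fun=> false) => d d'.
  rewrite !norm_pair_lt /= => /andP[_ hd] /andP[_ hd']; rewrite /ray_cross.
  suff -> : upper d = upper d' by rewrite addbb.
  rewrite /upper; move: rd hd hd'; rewrite ler_normr !ltr_norml => rd hd hd'.
  have [h|h] : 0 < d0.2 \/ d0.2 < 0 by move: rd; lra.
    have -> : 0 < d.2 by lra.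
    by have -> : 0 < d'.2 by lra.
  have h1 : d.2 < 0 by lra.
  have h2 : d'.2 < 0 by lra.
  by rewrite (lt_gtF h1) (lt_gtF h2) (lt_eqF h1) (lt_eqF h2).
Qed.

(** Crossing the negative half-axis is the same as crossing the axis but not the
    positive half-axis. *)
Lemma ray_crossN d d' : `|d' - d| < `|d| ->
  ray_cross (- d) (- d') = ray_cross d d' (+) (upper d (+) upper d').
Proof.
move=> dd.
have d0 : d != 0 by apply/eqP => d0; move: dd; rewrite d0 normr0 ltNge normr_ge0.
have d'0 : d' != 0.
  by apply/eqP => d'0; move: dd; rewrite d'0 sub0r normrN ltxx.
rewrite /ray_cross !upperN //= oppr_gt0.
have -> : ~~ upper d (+) ~~ upper d' = upper d (+) upper d'.
  by case: (upper d); case: (upper d').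
case U : (upper d (+) upper d') => //=; rewrite addbT -leNgt lt_neqAle.
suff -> : d.1 != 0 by [].
apply/eqP => d10; move: U; rewrite /upper d10 ltxx andbF orbF.
move: dd; rewrite norm_pair_lt [`|d|]norm_pairE d10 normr0 (max_idPr _) //= => /andP[_].
move=> dd.
have [h|[h|h]] : 0 < d.2 \/ d.2 < 0 \/ d.2 = 0 by lra.
- have -> : 0 < d'.2 by move: dd; rewrite (gtr0_norm h) ltr_norml; lra.
  by rewrite h.
- have h2 : d'.2 < 0 by move: dd; rewrite (ltr0_norm h) ltr_norml; lra.
  by rewrite (lt_gtF h) (lt_gtF h2) (lt_eqF h2).
- by case/eqP: d0; rewrite [d]surjective_pairing d10 h.
Qed.

Lemma compact_gap (A B : set (R * R)) : compact A -> compact B ->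
  A `&` B = set0 -> exists2 r : R, 0 < r & forall p q, A p -> B q -> r <= `|p - q|.
Proof.
move=> cA cB AB0.
pose K := (fun pq : (R * R) * (R * R) => pq.1 - pq.2) @` (A `*` B).
have cK : compact K.
  apply: continuous_compact; last exact: compact_setX.
  apply: continuous_subspaceT => x.
  by apply: continuousB; [exact: cvg_fst | exact: cvg_snd].
have K0 : ~ K 0.
  move=> [[p q]] /= [Ap Bq] /eqP; rewrite subr_eq0 => /eqP pq.
  by have : set0 p by rewrite -AB0; split=> //; rewrite pq.
have : nbhs (0 : R * R) (~` K).
  apply: open_nbhs_nbhs; split=> //; apply: closed_openC.
  by apply: compact_closed => //; exact: norm_hausdorff.
rewrite -nbhs_ballE => -[r /= r0 rK]; exists r => // p q Ap Bq.
rewrite leNgt; apply/negP => lt; apply: (rK (p - q)); last by exists (p, q).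
by rewrite -ball_normE /ball_ /= sub0r normrN.
Qed.

Definition sample g n k : R * R := g (k%:R / 2 ^+ n).

Lemma dyadic_itv n k : (k <= 2 ^ n)%N -> (k%:R / 2 ^+ n : R) \in `[0, 1].
Proof.
move=> kn; rewrite in_itv /=; apply/andP; split; first by rewrite divr_ge0 ?exprn_ge0.
by rewrite ler_pdivrMr ?exprn_gt0// mul1r -natrX ler_nat.
Qed.

Lemma curve_oscillation g (r : R) : {within `[0, 1], continuous g} -> 0 < r ->
  \forall n \near \oo, forall k, (k < 2 ^ n)%N ->
    `|sample g n k.+1 - sample g n k| < r.
Proof.
move=> cg r0.
have /compact_near_coveringP/near_covering_withinP cov := @segment_compact R 0 1.
pose P n (t : R) := forall t' : R, t' \in `[0, 1] ->
  `|t' - t| <= 2^-1 ^+ n -> `|g t' - g t| < r.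
have : \forall n \near \oo, `[0, 1]%classic `<=` P n.
  apply: cov => x Ix; move/subspace_continuousP: cg => /(_ x Ix) /cvgrPdist_lt.
  move=> /(_ (r / 2)); rewrite divr_gt0 // => /(_ isT).
  rewrite near_withinE => /nbhs_ballP[e /= e0 eg].
  have half0 : (fun n => (2^-1 : R) ^+ n) @ \oo --> (0 : R).
    by apply: cvg_expr; rewrite ger0_norm ?invr_ge0// invf_lt1 ?ltr1n.
  have he : \forall n \near \oo, (2^-1 : R) ^+ n < e / 2.
    move/cvgrPdist_lt: half0 => /(_ (e / 2)); rewrite divr_gt0 // => /(_ isT).
    by apply: filterS => n; rewrite sub0r normrN ger0_norm ?exprn_ge0 ?invr_ge0.
  have hx : \forall x' \near x, `|x - x'| < e / 2.
    by apply/nbhs_ballP; exists (e / 2) => //=; rewrite divr_gt0.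
  near=> x' i => Ix' t' It' tx.
  have xx : `|x - x'| < e / 2 by near: x'.
  have ie : (2^-1 : R) ^+ i < e / 2 by near: i.
  have h1 : `|g x - g x'| < r / 2.
    apply: (eg x') => //; rewrite /ball /=; lra.
  have h2 : `|g x - g t'| < r / 2.
    apply: (eg t') => //; rewrite /ball /=.
    rewrite -(subrKA x') (le_lt_trans (ler_normD _ _)) // [e]splitr ltrD //.
    by rewrite distrC (le_lt_trans tx).
  rewrite -(subrKA (g x)) (le_lt_trans (ler_normD _ _)) // [r]splitr ltrD //.
  by rewrite distrC.
apply: filterS => n nP k kn.
apply: nP => //; first exact/dyadic_itv/ltnW.
  exact: dyadic_itv.
by rewrite -mulrBl -natrB // subSn // subnn mul1r ger0_norm ?exprVn.
Unshelve. all: by end_near. Qed.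

Lemma addb_telescope (h : nat -> bool) m :
  \big[addb/false]_(k < m) (h k (+) h k.+1) = h 0 (+) h m.
Proof.
elim: m => [|m IH]; first by rewrite big_ord0 addbb.
by rewrite big_ord_recr /= IH; case: (h m); case: (h 0); case: (h m.+1).
Qed.

Lemma addb_big_double (F : nat -> bool) m :
  \big[addb/false]_(k < m.*2) F k =
  \big[addb/false]_(k < m) (F k.*2 (+) F k.*2.+1).
Proof.
elim: m => [|m IH]; first by rewrite !big_ord0.
by rewrite doubleS !big_ord_recr /= IH addbA.
Qed.

(** A discrete Stokes formula modulo 2. *)
Lemma addb_grid (H V : nat -> nat -> bool) m n :
  (forall i j, (i < m)%N -> (j < n)%N ->
     H i j (+) H i j.+1 = V i j (+) V i.+1 j) ->
  \big[addb/false]_(i < m) (H i 0 (+) H i n) =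
  \big[addb/false]_(j < n) (V 0 j (+) V m j).
Proof.
move=> cell.
transitivity (\big[addb/false]_(i < m) \big[addb/false]_(j < n)
    (H i j (+) H i j.+1)).
  by apply: eq_bigr => i _; rewrite (addb_telescope (H i)).
rewrite exchange_big /=; apply: eq_bigr => j _.
rewrite -(addb_telescope (V^~ j)); apply: eq_bigr => i _.
exact: cell.
Qed.

Definition crossings g n z : bool :=
  \big[addb/false]_(k < 2 ^ n) ray_cross (sample g n k - z) (sample g n k.+1 - z).

Definition curve_parity g z : bool := `[< \forall n \near \oo, crossings g n z >].

Lemma sample0 g n : sample g n 0 = g 0.
Proof. by rewrite /sample mul0r. Qed.

Lemma sample1 g n : sample g n (2 ^ n) = g 1.
Proof. by rewrite /sample natrX divff // expf_neq0. Qed.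

Lemma sampleS g n k : sample g n.+1 k.*2 = sample g n k.
Proof.
by rewrite /sample -muln2 natrM exprSr invfM mulrACA mulfV // mulr1.
Qed.

Lemma subBB (a b z : R * R) : (a - z) - (b - z) = a - b.
Proof. by rewrite opprB addrA subrK. Qed.

(** Dyadic subdivisions are used so that each one refines the previous one; a fine
    one computes the parity already, whence the limit in [curve_parity]. *)
Lemma crossings_refine g z (r : R) n : 0 < r ->
    (forall t : R, t \in `[0, 1] -> r <= `|g t - z|) ->
    (forall k, (k < 2 ^ n.+1)%N -> `|sample g n.+1 k.+1 - sample g n.+1 k| < r / 2) ->
  crossings g n.+1 z = crossings g n z.
Proof.
move=> r0 gap fine; rewrite /crossings expnS mul2n.
rewrite (addb_big_double (fun k => ray_cross (sample g n.+1 k - z)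
                                             (sample g n.+1 k.+1 - z))).
apply: eq_bigr => -[k kn] _ /=; rewrite -!(sampleS g n).
have lt1 : (k.*2 < 2 ^ n.+1)%N by rewrite expnS mul2n ltn_double.
have lt2 : (k.*2.+1 < 2 ^ n.+1)%N by rewrite expnS mul2n -doubleS -leq_double in kn *.
have [h hE] := ray_cross_potential r0 (gap _ (dyadic_itv (ltnW lt1))).
have f1 := fine _ lt1; have f2 := fine _ lt2.
rewrite -/(sample g n.+1 k.*2) in hE *; rewrite doubleS.
have r2 : r / 2 < r by lra.
have f3 : `|sample g n.+1 k.*2.+2 - sample g n.+1 k.*2| < r.
  rewrite -(subrKA (sample g n.+1 k.*2.+1)) (le_lt_trans (ler_normD _ _)) //.
  by rewrite [ltRHS]splitr ltrD.
rewrite !hE; rewrite ?subBB ?subrr ?normr0 ?(lt_trans f1) //.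
by case: (h _); case: (h _); case: (h _).
Qed.

Lemma near_curve_parity g z (r : R) : {within `[0, 1], continuous g} -> 0 < r ->
    (forall t : R, t \in `[0, 1] -> r <= `|g t - z|) ->
  \forall n \near \oo, crossings g n z = curve_parity g z.
Proof.
move=> cg r0 gap.
have [|N _ fine] := curve_oscillation (r := r / 2) cg; first by rewrite divr_gt0.
have const m : crossings g (N + m) z = crossings g N z.
  elim: m => [|m IH]; first by rewrite addn0.
  by rewrite addnS (crossings_refine r0 gap) //; apply: fine => /=; lia.
have const' n : (N <= n)%N -> crossings g n z = crossings g N z.
  by move=> /subnKC <-.
suff -> : curve_parity g z = crossings g N z by exists N.
apply/idP/idP => [/asboolP[M _ H]|H].
  by rewrite -(const M); apply: H => /=; lia.
by apply/asboolP; exists N => // n /= /const' ->.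
Qed.

(** Moving the point a little only matters at the two ends of the curve: in between
    the contributions telescope. *)
Lemma curve_parity_shift g z z' (r : R) : {within `[0, 1], continuous g} -> 0 < r ->
    (forall t : R, t \in `[0, 1] -> r <= `|g t - z|) -> `|z' - z| < r / 2 ->
  curve_parity g z' = curve_parity g z (+) (ray_cross (g 0 - z) (g 0 - z')
                              (+) ray_cross (g 1 - z) (g 1 - z')).
Proof.
move=> cg r0 gap zz.
have r20 : 0 < r / 2 by rewrite divr_gt0.
have gap' (t : R) : t \in `[0, 1] -> r / 2 <= `|g t - z'|.
  move=> /gap h; have := ler_normD (g t - z') (z' - z); rewrite subrKA; lra.
near \oo => n.
have <- : crossings g n z = curve_parity g z by near: n; exact: near_curve_parity cg r0 gap.
have <- : crossings g n z' = curve_parity g z' by near: n; exact: near_curve_parity cg r20 gap'.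
have fine : forall k, (k < 2 ^ n)%N -> `|sample g n k.+1 - sample g n k| < r / 2.
  by near: n; exact: curve_oscillation.
suff <- : crossings g n z (+) crossings g n z' =
  ray_cross (g 0 - z) (g 0 - z') (+) ray_cross (g 1 - z) (g 1 - z') by rewrite addKb.
rewrite /crossings -big_split /=.
pose v k := ray_cross (sample g n k - z) (sample g n k - z').
rewrite -(sample0 g n) -(sample1 g n) -/(v 0) -/(v (2 ^ n)%N) -(addb_telescope v).
apply: eq_bigr => -[k kn] _ /=; rewrite /v.
have [h hE] := ray_cross_potential r0 (gap _ (dyadic_itv (ltnW kn))).
rewrite -/(sample g n k) in hE *.
have fk := fine _ kn.
have e1 a : (a - z') - (a - z) = z - z' by rewrite opprB addrC subrKA.
have far : `|sample g n k.+1 - z' - (sample g n k - z)| < r.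
  have -> : sample g n k.+1 - z' - (sample g n k - z) =
     (sample g n k.+1 - sample g n k) - (z' - z).
    by rewrite !opprB addrACA [in RHS]addrACA; congr (_ + _); rewrite addrC.
  by rewrite [ltRHS]splitr (le_lt_trans (ler_normB _ _)) // ltrD.
have near1 : `|z - z'| < r by rewrite distrC; lra.
have near2 : `|sample g n k.+1 - sample g n k| < r by lra.
rewrite !hE ?subBB ?e1 ?subrr ?normr0 //.
by case: (h _); case: (h _); case: (h _); case: (h _).
Unshelve. all: by end_near. Qed.

(** The boundary of the parameter square, mapped by the difference of the two
    curves to the plane minus the origin, has parity zero.  Two opposite sides
    give the parities of [g]; on the other two sides the difference has the
    opposite sign, whence the correction by [upper] of the differences of ends. *)
Lemma curve_parity_exchange g g' : {within `[0, 1], continuous g} ->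
    {within `[0, 1], continuous g'} -> g @` `[0, 1] `&` g' @` `[0, 1] = set0 ->
  curve_parity g (g' 0) (+) curve_parity g (g' 1) (+)
  (curve_parity g' (g 0) (+) curve_parity g' (g 1)) =
  (upper (g' 0 - g 0) (+) upper (g' 1 - g 0)) (+)
  (upper (g' 0 - g 1) (+) upper (g' 1 - g 1)).
Proof.
move=> cg cg' disj.
have comp (f : R -> R * R) : {within `[0, 1], continuous f} -> compact (f @` `[0, 1]).
  by move=> cf; apply: continuous_compact => //; exact: segment_compact.
have [r r0 gap] := compact_gap (comp _ cg) (comp _ cg') disj.
have gap1 (t t' : R) : t \in `[0, 1] -> t' \in `[0, 1] -> r <= `|g t - g' t'|.
  by move=> It It'; apply: gap; [exists t | exists t'].
have r20 : 0 < r / 2 by rewrite divr_gt0.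
have I0 : (0 : R) \in `[0, 1] by rewrite in_itv /= lexx ler01.
have I1 : (1 : R) \in `[0, 1] by rewrite in_itv /= lexx ler01.
have E (t : R) : t \in `[0, 1] -> \forall n \near \oo,
    crossings g n (g' t) = curve_parity g (g' t).
  by move=> It; apply: (near_curve_parity cg r0) => t' It'; exact: gap1.
have E' (t : R) : t \in `[0, 1] -> \forall n \near \oo,
    crossings g' n (g t) = curve_parity g' (g t).
  by move=> It; apply: (near_curve_parity cg' r0) => t' It'; rewrite distrC; exact: gap1.
near \oo => n.
have fine : forall k, (k < 2 ^ n)%N -> `|sample g n k.+1 - sample g n k| < r / 2.
  by near: n; exact: curve_oscillation.
have fine' : forall k, (k < 2 ^ n)%N -> `|sample g' n k.+1 - sample g' n k| < r / 2.
  by near: n; exact: curve_oscillation.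
have <- : crossings g n (g' 0) = curve_parity g (g' 0) by near: n; exact: E.
have <- : crossings g n (g' 1) = curve_parity g (g' 1) by near: n; exact: E.
have <- : crossings g' n (g 0) = curve_parity g' (g 0) by near: n; exact: E'.
have <- : crossings g' n (g 1) = curve_parity g' (g 1) by near: n; exact: E'.
pose p := sample g n; pose q := sample g' n.
have swapE x (t : R) : x = g t -> t \in `[0, 1] ->
    \big[addb/false]_(j < 2 ^ n) ray_cross (x - q j) (x - q j.+1) =
    crossings g' n x (+) (upper (g' 0 - x) (+) upper (g' 1 - x)).
  move=> -> It.
  rewrite -(sample0 g' n) -(sample1 g' n).
  rewrite -(addb_telescope (fun k => upper (sample g' n k - g t))) -big_split /=.
  apply: eq_bigr => -[k kn] _ /=; rewrite /q.
  have small : `|(sample g' n k.+1 - g t) - (sample g' n k - g t)| <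
      `|sample g' n k - g t|.
    rewrite subBB; apply: lt_le_trans (fine' _ kn) _; rewrite [leRHS]distrC.
    have := gap1 _ _ It (dyadic_itv (ltnW kn)); rewrite -/(sample g' n k); lra.
  by rewrite -(ray_crossN small) !opprB.
(* the two kinds of sides of the cells of the parameter square *)
pose H i j := ray_cross (p i - q j) (p i.+1 - q j).
pose V i j := ray_cross (p i - q j) (p i - q j.+1).
have cell i j : (i < 2 ^ n)%N -> (j < 2 ^ n)%N ->
    H i j (+) H i j.+1 = V i j (+) V i.+1 j.
  move=> li lj; rewrite /H /V.
  have [h hE] := ray_cross_potential r0
    (gap1 _ _ (dyadic_itv (ltnW li)) (dyadic_itv (ltnW lj))).
  rewrite -/(sample g n i) -/(sample g' n j) -/(p i) -/(q j) in hE.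
  have fi : `|p i.+1 - p i| < r / 2 := fine _ li.
  have fj : `|q j - q j.+1| < r / 2 by rewrite distrC; exact: fine'.
  have e1 a : (a - q j.+1) - (a - q j) = q j - q j.+1.
    by rewrite opprB addrC subrKA.
  have far : `|p i.+1 - q j.+1 - (p i - q j)| < r.
    have -> : p i.+1 - q j.+1 - (p i - q j) = (p i.+1 - p i) + (q j - q j.+1).
      by rewrite opprB addrACA [in RHS]addrACA; congr (_ + _); rewrite addrC.
    by rewrite [ltRHS]splitr (le_lt_trans (ler_normD _ _)) // ltrD.
  have near1 : `|q j - q j.+1| < r by lra.
  have near2 : `|p i.+1 - p i| < r by lra.
  rewrite !hE ?subBB ?e1 ?subrr ?normr0 //.
  by case: (h _); case: (h _); case: (h _); case: (h _).
have := addb_grid cell.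
rewrite !big_split /= /H /V (swapE _ 0) //; last by rewrite /p sample0.
rewrite (swapE _ 1) //; last by rewrite /p sample1.
rewrite /p /q !sample0 !sample1 -/(crossings g n (g' 0)) -/(crossings g n (g' 1)).
move=> ->; case: (crossings g' n (g 0)); case: (crossings g' n (g 1)) => /=;
by do 2!case: (upper (_ - g 0)); do 2!case: (upper (_ - g 1)).
Unshelve. all: by end_near. Qed.

End PlaneCrossings.

(** * The tournament of an outerplanar drawing *)

Section DrawnGraph.
Variables (R : realType) (V : finType) (e : rel V).
Local Open Scope classical_set_scope.
Local Open Scope ring_scope.
Variables (pos : V -> R * R) (g : V -> V -> R -> R * R).
Hypothesis g_cont : forall x y, e x y -> {within `[0, 1], continuous (g x y)}.
Hypothesis g_0 : forall x y, e x y -> g x y 0 = pos x.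
Hypothesis g_1 : forall x y, e x y -> g x y 1 = pos y.

Let trace x y := g x y @` `[0, 1].

Let trace_compact x y : e x y -> compact (trace x y).
Proof.
by move=> /g_cont cg; apply: continuous_compact cg _; exact: segment_compact.
Qed.

(** Equivalently, the parities at [z] add up to zero over every closed walk in [Q]. *)
Definition parity_coboundary (Q : rel V) (z : R * R) : Prop :=
  exists b : V -> bool, forall x y, Q x y -> curve_parity (g x y) z = b x (+) b y.

Lemma trace_gap x y z : e x y -> ~ trace x y z ->
  exists2 r : R, 0 < r & forall t : R, t \in `[0, 1] -> r <= `|g x y t - z|.
Proof.
move=> exy nz; have [|r r0 gap] := compact_gap (trace_compact exy) (@compact_set1 _ z).
  by apply/seteqP; split => // p [pt pz]; apply: nz; rewrite -pz.
by exists r => // t It; apply: gap => //; exists t.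
Qed.

Lemma parity_coboundary_shift (Q : rel V) z0 : subrel Q e ->
    (forall x y, Q x y -> ~ trace x y z0) ->
  \forall z \near z0, parity_coboundary Q z <-> parity_coboundary Q z0.
Proof.
move=> Qe away.
pose shift (xy : V * V) z := Q xy.1 xy.2 ->
    curve_parity (g xy.1 xy.2) z = curve_parity (g xy.1 xy.2) z0 (+)
      (ray_cross (pos xy.1 - z0) (pos xy.1 - z) (+)
       ray_cross (pos xy.2 - z0) (pos xy.2 - z)).
have : \forall z \near z0, forall xy, shift xy z.
  apply: (@filter_forall (R * R)%type (V * V)%type shift (nbhs z0) _) => -[x y] /=.
  have [Qxy|/negP nQ] := boolP (Q x y); last by apply: nearW => z /nQ.
  have exy := Qe _ _ Qxy; have [r r0 gap] := trace_gap exy (away _ _ Qxy).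
  apply/nbhs_ballP; exists (r / 2) => /=; first by rewrite divr_gt0.
  move=> z zb _; rewrite (curve_parity_shift (g_cont exy) r0 gap) ?g_0 ?g_1 //.
  by move: zb; rewrite -ball_normE /= distrC.
apply: filterS => z zs; split=> -[b bE].
  exists (fun x => b x (+) ray_cross (pos x - z0) (pos x - z)) => x y Qxy.
  move: (zs (x, y) Qxy) (bE _ _ Qxy) => /= -> .
  by case: (curve_parity _ _); do 2!case: (ray_cross _ _); do 2!case: (b _).
exists (fun x => b x (+) ray_cross (pos x - z0) (pos x - z)) => x y Qxy.
move: (zs (x, y) Qxy) (bE _ _ Qxy) => /= -> -> .
by do 2!case: (ray_cross _ _); do 2!case: (b _).
Qed.

(** Seen from far away the drawing lies in a ball missing the origin. *)
Lemma parity_coboundary_far :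
  exists M : R, forall z, M < `|z| -> parity_coboundary e z.
Proof.
pose bound (xy : V * V) (M : R) := e xy.1 xy.2 ->
    forall p, trace xy.1 xy.2 p -> `|p| <= M.
have : \forall M \near +oo, forall xy, bound xy M.
  apply: (@filter_forall R (V * V)%type bound +oo _) => -[x y] /=.
  have [exy|/negP nexy] := boolP (e x y); last by apply: nearW => M /nexy.
  have [N [Nreal NP]] := compact_bounded (trace_compact exy).
  by exists N; split => // M /NP H _ p; exact: H.
move=> [M0 [_ MP]]; pose M := Num.max (M0 + 1) 0.
have {}MP : forall xy, bound xy M.
  by apply: MP; rewrite lt_max ltrDl ltr01.
exists M => z zM.
have z0 : 0 < `|z| by apply: le_lt_trans zM; rewrite le_max lexx orbT.
have zN : `|z| <= `|- z| by rewrite normrN.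
have [h hE] := ray_cross_potential z0 zN.
exists (fun x => h (pos x - z)) => x y exy.
have cross n : crossings (g x y) n z = h (pos x - z) (+) h (pos y - z).
  rewrite -(g_0 exy) -(g_1 exy) -(sample0 _ n) -(sample1 _ n).
  rewrite -(addb_telescope (fun k => h (sample (g x y) n k - z))).
  have near0 k : (k <= 2 ^ n)%N -> `|sample (g x y) n k - z - - z| < `|z|.
    move=> kn; rewrite opprK subrK; apply: le_lt_trans zM.
    by apply: (MP (x, y)) => //; exists (k%:R / 2 ^+ n) => //; exact: dyadic_itv.
  by apply: eq_bigr => -[k kn] _ /=; apply: hE; apply: near0 => //; exact: ltnW.
rewrite -(cross 0%N); apply/idP/idP => [/asboolP[N _ H]|H].
  by rewrite (cross 0%N) -(cross N); apply: H => /=.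
by apply/asboolP; exists 0%N => // n _ /=; rewrite cross -(cross 0%N).
Qed.

Let drawing := [set p | exists x y, e x y /\ trace x y p].

(** The property is locally constant off the drawing, hence constant on the
    component, which contains points far away. *)
Lemma parity_coboundary_unbounded q : ~ drawing q ->
    ~ bounded_set (connected_component (~` drawing) q) ->
  parity_coboundary e q.
Proof.
move=> nDq unb; set K := connected_component _ _ in unb.
have KD : K `<=` ~` drawing by exact: connected_component_sub.
have Kshift z : K z -> \forall z' \near z,
    parity_coboundary e z' <-> parity_coboundary e z.
  move=> /KD nDz; apply: parity_coboundary_shift => // x y exy txy.
  by apply: nDz; exists x, y.
pose C := [set z | parity_coboundary e z].
have Kconn : connected K by exact: component_connected.
have KC : K `&` C = K.
  apply: Kconn.
  - have [M MP] := parity_coboundary_far.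
    apply: contrapT => KC0; apply: unb; exists M; split; first exact: num_real.
    move=> M' MM' z Kz /=; rewrite leNgt; apply/negP => zM'.
    by apply: KC0; exists z; split => //; apply: MP; exact: lt_trans zM'.
  - exists (C°); first exact: open_interior.
    apply/seteqP; split => z [Kz]; last by move/interior_subset.
    move=> Cz; split => //; have := Kshift _ Kz.
    by apply: filterS => z' zz; apply/zz.
  - exists (~` ((~` C)°)); first by apply: open_closedC; exact: open_interior.
    apply/seteqP; split => z [Kz Cz]; split => //.
      by move/interior_subset.
    apply: contrapT => nCz; apply: Cz; have := Kshift _ Kz.
    by apply: filterS => z' zz Cz'; apply: nCz; apply/zz.
have : K q by exact: connected_component_refl.
by rewrite -KC => -[].
Qed.

End DrawnGraph.

Section OuterplanarTournament.
Local Open Scope classical_set_scope.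
Local Open Scope ring_scope.

(** For [t u x] take [b u x (+) b x u] corrected by the position of [pos x] with
    respect to [pos u]: the correction makes [t] antisymmetric, and the exchange
    relation for two disjoint edges becomes the vanishing of [link]. *)
Lemma outerplanar_tournament (R : realType) (V : finType) (e : rel V) :
  irreflexive e -> outerplanar R e -> exists t, outer_tournament e t.
Proof.
move=> e_irr [pos [arc [[pos_inj arcP _ arc_pos arc_meet] outer]]].
have /choice[g gP] : forall xy : V * V, exists f : R -> R * R, e xy.1 xy.2 ->
    [/\ {within `[0, 1], continuous f}, f 0 = pos xy.1, f 1 = pos xy.2 &
        arc xy.1 xy.2 = f @` `[0, 1]].
  move=> [x y] /=.
  have [exy|/negP nexy] := boolP (e x y); last by exists (fun=> pos x).
  by have [f [? _ ? ? ?]] := arcP _ _ exy; exists f.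
pose G x y := g (x, y).
have G_cont x y : e x y -> {within `[0, 1], continuous (G x y)}.
  by move=> exy; case: (gP (x, y) exy).
have G_0 x y : e x y -> G x y 0 = pos x by move=> exy; case: (gP (x, y) exy).
have G_1 x y : e x y -> G x y 1 = pos y by move=> exy; case: (gP (x, y) exy).
have G_arc x y : e x y -> arc x y = (G x y @` `[0, 1]).
  by move=> exy; case: (gP (x, y) exy).
have arc_vertex x y w : e x y -> arc x y (pos w) -> w = x \/ w = y.
  move=> exy aw; have [|/pos_inj|/pos_inj] := arc_pos _ _ exy (pos w); auto.
  by split => //; exists w.
have [b bP] : exists b : V -> V -> bool, forall w x y, e x y ->
    x != w -> y != w -> curve_parity (G x y) (pos w) = b w x (+) b w y.
  suff /choice[b bP] : forall w, exists b : V -> bool, forall x y,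
      [&& e x y, x != w & y != w] -> curve_parity (G x y) (pos w) = b x (+) b y.
    by exists b => w x y exy xw yw; apply: bP; rewrite exy xw yw.
  move=> w; pose Q x y := [&& e x y, x != w & y != w].
  have Qe : subrel Q e by move=> x y /andP[].
  have away x y : Q x y -> ~ (G x y @` `[0, 1]) (pos w).
    move=> /and3P[exy xw yw]; rewrite -G_arc // => /(arc_vertex _ _ _ exy).
    by case=> E; [move: xw | move: yw]; rewrite E eqxx.
  have := parity_coboundary_shift G_cont G_0 G_1 Qe away.
  move=> /(outer w)[q [[nDq unb]] qw]; apply/qw.
  have nD : ~ (exists x y, e x y /\ (G x y @` `[0, 1]) q).
    by move=> [x [y [exy]]]; rewrite -G_arc // => aq; apply: nDq; right; exists x, y.
  have sub : connected_component (~` drawing_points e pos arc) q `<=`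
      connected_component (~` [set p | exists x y, e x y /\ (G x y @` `[0, 1]) p]) q.
    move=> z [B [Bq BD Bconn] Bz]; exists B => //; split => //.
    move=> p /BD nDp [x [y [exy]]]; rewrite -G_arc // => ap.
    by apply: nDp; right; exists x, y.
  have [] := @parity_coboundary_unbounded R V e pos G G_cont G_0 G_1 q nD.
    move=> [M [Mreal MP]]; apply: unb; exists M; split => // M' MM' z zB.
    exact: MP MM' _ (sub _ zB).
  by move=> b bP; exists b => x y /Qe/bP.
pose t u x := b u x (+) b x u (+) upper (pos x - pos u).
exists t; split=> [x y xy|x y u v exy euv xu xv yu yv].
  rewrite /t -opprB upperN; last by rewrite subr_eq0; apply: contra_neq xy => /pos_inj.
  by rewrite (addbC (b y x)) addbN.
have disj : G x y @` `[0, 1] `&` G u v @` `[0, 1] = set0.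
  apply/seteqP; split => // p; rewrite -!G_arc // => -[pxy puv].
  have [w _ wp] : range pos p.
    apply: (arc_meet x y u v) => // /seteqP[/(_ x)] /=.
    by case=> [|/eqP|/eqP]; rewrite ?(negPf xu) ?(negPf xv) //; left.
  rewrite -wp in pxy puv.
  have [wx|wy] := arc_vertex _ _ _ exy pxy; have [wu|wv] := arc_vertex _ _ _ euv puv;
    by [move: xu xv yu yv; rewrite -?wx -?wy -?wu -?wv eqxx].
have := curve_parity_exchange (G_cont _ _ exy) (G_cont _ _ euv) disj.
rewrite !G_0 // !G_1 // (bP u) // (bP v) //.
rewrite (bP x) 1?eq_sym // 1?[v != _]eq_sym // (bP y) 1?eq_sym // 1?[v != _]eq_sym //.
have regroup z : t z u (+) t z v = (b z u (+) b z v) (+) (b u z (+) b v z) (+)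
    (upper (pos u - pos z) (+) upper (pos v - pos z)).
  by rewrite /t; case: (b z u); case: (b z v); case: (b u z); case: (b v z);
     case: (upper _); case: (upper _).
rewrite /link !regroup.
move: (b x u (+) b x v) (b y u (+) b y v) (upper _ (+) upper _) (upper _ (+) upper _).
by case: (b u x); case: (b u y); case: (b v x); case: (b v y); do 4!case.
Qed.
End OuterplanarTournament.

(** * Drawing a noncrossing order on a parabola *)

Section ParabolaDrawing.
Local Open Scope classical_set_scope.
Local Open Scope ring_scope.
Variables (R : realType) (V : finType) (e : rel V) (F : V -> R).
Hypotheses (e_sym : symmetric e) (e_irr : irreflexive e) (F_inj : injective F).
Hypothesis F_nc : forall x y u v, e x y -> e u v ->
  F x < F u -> F u < F y -> F y < F v -> False.

Definition parabola_pos x : R * R := (F x, F x ^+ 2).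

Definition chord (x y : V) : set (R * R) :=
  [set p | (F x <= p.1 <= F y \/ F y <= p.1 <= F x) /\
           p.2 = (F x + F y) * p.1 - F x * F y].

Lemma chordC x y : chord x y = chord y x.
Proof.
by apply/seteqP; split=> p /= [h p2]; rewrite /chord /= p2;
  (split; [case: h; auto|ring]).
Qed.

Lemma chord_vertex x y z : chord x y (parabola_pos z) -> z = x \/ z = y.
Proof.
case=> _ /= h; have : (F z - F x) * (F z - F y) = 0 by move: h; lra.
by move/eqP; rewrite mulf_eq0 !subr_eq0 => /orP[]/eqP/F_inj; auto.
Qed.

Lemma chord_above x y p : chord x y p -> p.1 ^+ 2 <= p.2.
Proof. by case=> -[]/andP[h1 h2] p2; nra. Qed.

Lemma chord_is_arc x y : x != y -> is_arc (chord x y) (parabola_pos x) (parabola_pos y).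
Proof.
move=> xy; have Fxy : F y - F x != 0.
  by rewrite subr_eq0 eq_sym; apply: contra_neq xy => /F_inj.
pose g1 (t : R) : R := F x + t * (F y - F x).
pose g2 (t : R) : R := F x ^+ 2 + t * (F y ^+ 2 - F x ^+ 2).
exists (fun t => (g1 t, g2 t)); split.
- apply: continuous_subspaceT => t.
  have c1 : {for t, continuous g1}.
    apply: continuousD; first exact: cvg_cst.
    by apply: continuousM; [exact: cvg_id|exact: cvg_cst].
  have c2 : {for t, continuous g2}.
    apply: continuousD; first exact: cvg_cst.
    by apply: continuousM; [exact: cvg_id|exact: cvg_cst].
  exact: (cvg_pair c1 c2).
- move=> s t _ _ E; have E1 : g1 s = g1 t := congr1 fst E.
  by apply: (mulIf Fxy); apply: (@addrI _ (F x)); exact: E1.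
- by rewrite /g1 /g2 !mul0r !addr0.
- by rewrite /g1 /g2 !mul1r ![_ + (_ - _)]addrC !subrK.
- apply/seteqP; split=> p.
  + case=> h p2; exists ((p.1 - F x) / (F y - F x)).
      rewrite /= in_itv /=; move: Fxy; rewrite neq_lt => /orP[neg|pos].
        rewrite ler_ndivlMr // ler_ndivrMr //; lra.
      rewrite ler_pdivlMr // ler_pdivrMr //; lra.
    rewrite /g1 /g2 [RHS]surjective_pairing p2; congr pair.
      by rewrite divfK // addrC subrK.
    rewrite subr_sqr mulrA divfK //; ring.
  + move=> [t /=]; rewrite in_itv /= => /andP[t0 t1] <-; split=> /=.
      rewrite /g1; have [h|h] := lerP (F x) (F y); [left|right]; apply/andP; split; nra.
    rewrite /g1 /g2; ring.
Qed.

(** The product of [z - a] and [b - z] strictly increases with the interval.  For a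
    chord of the parabola over the interval from [a] to [b] it is the height of
    the chord above the parabola at [z]. *)
Lemma chord_power_inj (a b c d z : R) : a < z < b -> c < z < d ->
    (z - a) * (b - z) = (z - c) * (d - z) ->
    ~ (a < c /\ b < d) -> ~ (c < a /\ d < b) -> a = c /\ b = d.
Proof.
move=> /andP[az zb] /andP[cz zd] E n1 n2.
have [ac|ca|ac] := ltgtP a c.
- have db : d <= b by rewrite leNgt; apply/negP => ?; exact: n1.
  nra.
- have bd : b <= d by rewrite leNgt; apply/negP => ?; exact: n2.
  nra.
- split=> //; have [bd|db|//] := ltgtP b d; nra.
Qed.

Lemma chord_meet_lt x y u v p : e x y -> e u v -> F x < F y -> F u < F v ->
  chord x y p -> chord u v p -> (exists w, parabola_pos w = p) \/ x = u /\ y = v.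
Proof.
move=> exy euv xy uv [hxy pxy] [huv puv].
have {}hxy : F x <= p.1 <= F y by case: hxy => /andP[? ?]; lra.
have {}huv : F u <= p.1 <= F v by case: huv => /andP[? ?]; lra.
have vertex w : p.1 = F w -> (w = x \/ w = y) \/ (w = u \/ w = v) ->
    exists w, parabola_pos w = p.
  move=> pw H; exists w; rewrite /parabola_pos [RHS]surjective_pairing pw.
  congr pair; case: H => -[] E; rewrite E in pw *;
    [rewrite pxy | rewrite pxy | rewrite puv | rewrite puv]; rewrite pw; ring.
have [E|nx] := eqVneq p.1 (F x); first by left; apply: (vertex x E); auto.
have [E|ny] := eqVneq p.1 (F y); first by left; apply: (vertex y E); auto.
have [E|nu] := eqVneq p.1 (F u); first by left; apply: (vertex u E); auto.
have [E|nv] := eqVneq p.1 (F v); first by left; apply: (vertex v E); auto.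
have sxy : F x < p.1 < F y.
  rewrite lt_neqAle [_ == p.1]eq_sym nx [p.1 < _]lt_neqAle ny.
  by case/andP: hxy => -> ->.
have suv : F u < p.1 < F v.
  rewrite lt_neqAle [_ == p.1]eq_sym nu [p.1 < _]lt_neqAle nv.
  by case/andP: huv => -> ->.
have [|||/F_inj xu /F_inj yv] := @chord_power_inj (F x) (F y) (F u) (F v) p.1 sxy suv.
- lra.
- move=> [xu yv]; apply: (F_nc exy euv) => //; lra.
- move=> [ux vy]; apply: (F_nc euv exy) => //; lra.
- by right.
Qed.

Lemma chord_meet x y u v p : e x y -> e u v -> [set x; y] <> [set u; v] ->
  chord x y p -> chord u v p -> exists w, parabola_pos w = p.
Proof.
move=> exy euv neq pxy puv.
have Fneq a b : e a b -> F a < F b \/ F b < F a.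
  move=> eab; apply/orP; rewrite -neq_lt (inj_eq F_inj).
  by apply: contraTneq eab => ->; rewrite e_irr.
have eyx : e y x by rewrite e_sym.
have evu : e v u by rewrite e_sym.
have pyx : chord y x p by rewrite chordC.
have pvu : chord v u p by rewrite chordC.
have [xy|yx] := Fneq _ _ exy; have [uv|vu] := Fneq _ _ euv.
- by have [//|[E1 E2]] := chord_meet_lt exy euv xy uv pxy puv; case: neq; rewrite E1 E2.
- by have [//|[E1 E2]] := chord_meet_lt exy evu xy vu pxy pvu; case: neq; rewrite E1 E2 setUC.
- by have [//|[E1 E2]] := chord_meet_lt eyx euv yx uv pyx puv; case: neq; rewrite E1 E2 setUC.
- by have [//|[E1 E2]] := chord_meet_lt eyx evu yx vu pyx pvu; case: neq; rewrite E1 E2.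
Qed.

(** The whole vertical ray below the vertex misses the drawing, which lies above
    the parabola. *)
Lemma below_parabola_outer z c : c < F z ^+ 2 ->
  outer_face (drawing_points e parabola_pos chord) (F z, c).
Proof.
move=> cz; set D := drawing_points _ _ _.
have aboveD p : D p -> p.1 ^+ 2 <= p.2.
  by case=> [[w _ <-] //=|[x [y [_]]]]; exact: chord_above.
pose ray := (fun s : R => (F z, s)) @` `]-oo, (F z ^+ 2)[.
have ray_conn : connected ray.
  apply: connected_continuous_connected.
    by apply/connected_intervalP; exact: interval_is_interval.
  apply: continuous_subspaceT => s.
  have c1 : {for s, continuous (fun _ : R => F z)} by exact: cvg_cst.
  have c2 : {for s, continuous (@id R)} by exact: cvg_id.
  exact: (cvg_pair c1 c2).
have rayD : ray `<=` ~` D.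
  by move=> _ [s /= + <-] /aboveD /=; rewrite in_itv /= => lt; rewrite leNgt lt.
have rayc : ray (F z, c) by exists c; rewrite //= in_itv.
split; first exact: rayD.
move=> [M [_ /(_ (`|M| + 1))]].
have MM : M < `|M| + 1 by have := ler_norm M; lra.
move=> /(_ MM) bnd.
pose s := - (`|M| + 2).
have rs : ray (F z, s).
  exists s => //=; rewrite in_itv /= /s; have := normr_ge0 M; have := sqr_ge0 (F z); lra.
have := bnd _ (connected_component_max rayc rayD ray_conn rs).
rewrite /= prod_normE /= ge_max => /andP[_].
rewrite /s normrN ger0_norm; have := normr_ge0 M; lra.
Qed.

Lemma noncrossing_outerplanar_real : outerplanar R e.
Proof.
exists parabola_pos, chord; split; first split.
- by move=> x y [/F_inj].
- by move=> x y exy; apply: chord_is_arc; apply: contraTneq exy => ->; rewrite e_irr.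
- by move=> x y _; exact: chordC.
- move=> x y _ p [pxy [z _ zp]]; rewrite -zp in pxy *.
  by have [->|->] := chord_vertex pxy; [left|right].
- move=> x y u v exy euv neq p [pxy puv].
  by have [w <-] := chord_meet exy euv neq pxy puv; exists w.
- move=> z B /nbhs_ballP[r /= r0 rB].
  exists (F z, F z ^+ 2 - r / 2); split.
    by apply: below_parabola_outer; rewrite ltrBlDr ltrDl divr_gt0.
  apply: rB; split=> /=; first exact: ballxx.
  rewrite /ball /= opprB addrC subrK ger0_norm ?divr_ge0 ?ltW //; lra.
Qed.

End ParabolaDrawing.

Lemma noncrossing_outerplanar (R : realType) (V : finType) (e : rel V) (f : V -> nat) :
  symmetric e -> irreflexive e -> injective f -> noncrossing e f -> outerplanar R e.
Proof.
move=> e_sym e_irr f_inj nc.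
apply: (@noncrossing_outerplanar_real R V e (fun x => (f x)%:R%R)) => //.
  by move=> x y /eqP; rewrite eqr_nat => /eqP/f_inj.
by move=> x y u v exy euv; rewrite !ltr_nat; exact: nc.
Qed.

(** * Maximal outerplanar graphs are triangulated polygons *)

Lemma add_edge_sym (V : finType) (e : rel V) x y :
  symmetric e -> symmetric (add_edge e x y).
Proof.
move=> e_sym u v; rewrite /add_edge e_sym; congr (_ || _).
by rewrite orbC ![(v == _) && _]andbC.
Qed.

Lemma add_edge_irr (V : finType) (e : rel V) x y :
  x != y -> irreflexive e -> irreflexive (add_edge e x y).
Proof.
move=> xy e_irr u; rewrite /add_edge e_irr /=.
by apply/negP => /orP[]/andP[/eqP E1 /eqP E2]; move: xy; rewrite -E1 -E2 eqxx.
Qed.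

(** If a nonadjacent pair were not crossed by an edge, joining it would keep the
    order noncrossing, hence the graph outerplanar. *)
Lemma maximal_outerplanar_polygon (R : realType) (V : finType) (e : rel V) :
    maximal_outerplanar R e ->
  exists f : V -> nat, [/\ injective f, forall x, f x < #|V|,
    noncrossing e f & crossed e f].
Proof.
move=> [[e_sym e_irr] e_out e_max].
have [t et] := outerplanar_tournament e_irr e_out.
have [f0 [f0_inj nc0]] := noncrossing_order e_sym e_irr et.
have [f [f_inj f_lt f_mono]] := rank_label f0_inj.
have nc : noncrossing e f by move=> x y u v; rewrite !f_mono; exact: nc0.
exists f; split=> // x y xy nexy.
have neq : x != y by apply: contraTneq xy => ->; rewrite ltnn.
apply: contrapT => ncross; apply: (e_max x y neq nexy).
apply: (@noncrossing_outerplanar R V _ f) => //.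
- exact: add_edge_sym.
- exact: add_edge_irr.
have block u v : e u v -> f x < f u < f y -> f x <= f v <= f y.
  move=> euv xuy; apply/negPn/negP => nv; apply: ncross; exists u, v; split=> //.
  by clear -nv; lia.
move=> a b c d /or3P[ab|/andP[/eqP -> /eqP ->]|/andP[/eqP -> /eqP ->]]
  /or3P[cd|/andP[/eqP -> /eqP ->]|/andP[/eqP -> /eqP ->]] ac cb bd;
  try (clear -xy ac cb bd; lia).
- exact: nc ab cd ac cb bd.
- by rewrite e_sym in ab; have := block _ _ ab; clear -ac cb bd; lia.
- by have := block _ _ cd; clear -ac cb bd; lia.
Qed.

(** A larger graph keeps the Hamiltonian cycle, so if it were outerplanar the same
    order would be noncrossing for it, although a new edge is crossed. *)
Lemma polygon_maximal_outerplanar (R : realType) (V : finType) (e : rel V)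
    (f : V -> nat) (at_ : nat -> V) : symmetric e -> irreflexive e ->
  labelling f at_ -> noncrossing e f -> crossed e f -> maximal_outerplanar R e.
Proof.
move=> e_sym e_irr lab nc cr.
have f_inj : injective f := can_inj (labelK lab).
split=> //; first exact: (noncrossing_outerplanar R e_sym e_irr f_inj nc).
move=> x y xy nexy out.
have [t et] := outerplanar_tournament (add_edge_irr xy e_irr) out.
have sub : subrel e (add_edge e x y) by move=> u v; rewrite /add_edge => ->.
have nc' : noncrossing (add_edge e x y) f.
  apply: (hamiltonian_noncrossing (add_edge_sym x y e_sym) lab _ _ et).
    by move=> i lti; apply: sub; exact: (triangulation_succ lab cr).
  by move=> lt; apply: sub; exact: (triangulation_wrap lab cr).
have new : add_edge e x y x y by rewrite /add_edge !eqxx orbT.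
have new' : add_edge e x y y x by rewrite add_edge_sym.
have no a b : add_edge e x y a b -> f a < f b -> ~~ e a b -> False.
  move=> ab ltab nab; have [u [v [euv aub [va|bv]]]] := cr a b ltab nab.
    by apply: (nc' v u a b (sub _ _ _) ab); rewrite 1?e_sym //; clear -aub va; lia.
  by apply: (nc' a b u v ab (sub _ _ euv)); clear -aub bv; lia.
have : f x != f y by rewrite inj_eq.
rewrite neq_ltn => /orP[ltxy|ltyx]; first exact: no new ltxy nexy.
by apply: no new' ltyx _; rewrite e_sym.
Qed.

Lemma fan_maximal_outerplanar (R : realType) m : maximal_outerplanar R (@fan m).
Proof.
have e_sym : symmetric (@fan m) by move=> x y; rewrite /fan fan_adjC.
apply: (polygon_maximal_outerplanar R e_sym _ (fan_labelling m)).
- by move=> x; rewrite /fan fan_adj_irr.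
- by move=> x y u v; exact: fan_noncrossing.
- move=> x y xy nexy; have [|k [l [kl xky ln side]]] := @fan_crossed m x y _ nexy.
    by rewrite xy ltn_ord.
  have kn : k < (9 * m).+2 by have := ltn_ord y; clear -xky; lia.
  by exists (Ordinal kn), (Ordinal ln).
Qed.

Theorem theorem2p8 (R : realType) :
  (forall (V : finType) (e : rel V), maximal_outerplanar R e ->
     (6 <= #|V|)%N -> (4 <= mp e)%N /\ (mp e <= #|V| - 1)%N) /\
  (forall N : nat, exists (V : finType) (e : rel V),
     [/\ maximal_outerplanar R e, (N <= #|V|)%N & mp e = 4%N]) /\
  (forall N : nat, exists (V : finType) (e : rel V),
     [/\ maximal_outerplanar R e, (N <= #|V|)%N,
         (forall x y : V, ~~ regular_edge e x y) & mp e = 4%N]).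
Proof.
have bounds (V : finType) (e : rel V) : maximal_outerplanar R e ->
    6 <= #|V| -> 4 <= mp e /\ mp e <= #|V| - 1.
  move=> emax V6; have [f [f_inj f_lt nc cr]] := maximal_outerplanar_polygon emax.
  have [[e_sym e_irr] _ _] := emax.
  have [at_ lab] := labelling_exists f_inj f_lt (leq_trans (isT : 0 < 6) V6).
  split; first exact: (mp_ge4 e_sym e_irr lab nc cr V6).
  by apply: (mp_lt_card e_sym e_irr lab nc cr); exact: leq_trans V6.
have irregular N : exists (V : finType) (e : rel V),
    [/\ maximal_outerplanar R e, N <= #|V|,
        forall x y : V, ~~ regular_edge e x y & mp e = 4].
  pose m := N + 3; have m3 : 3 <= m by rewrite leq_addl.
  have emax := fan_maximal_outerplanar R m.
  exists 'I_(9 * m).+2, (@fan m); split=> //.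
  - by rewrite card_ord /m; lia.
  - exact: fan_irregular.
  - apply/eqP; rewrite eqn_leq mp_fan_le4 //=.
    by have [|] := bounds _ _ emax; first by rewrite card_ord; lia.
split; first exact: bounds.
split=> // N; have [V [e [emax NV _ mp4]]] := irregular N.
by exists V, e.
Qed.
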